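(* The relation $\to\;=\;\to_\beta\cup\to_{\mathcal{R}}$ terminates on terms typable in $\lambda\Pi/\mathcal{R}$ (i.e. every $t$ such that $\Gamma\vdash t:T$ for some $\Gamma,T$ admits no infinite $\to$-reduction) if $\to$ is locally confluent and preserves typing, $\mathcal{R}$ is well-structured and accessible, and $\tilde{<}$ terminates.
   Context: Terms of $\lambda\Pi/\mathcal{R}$: $t ::= s \mid x \mid f \mid \Pi x{:}t.t \mid t\,t \mid \lambda x{:}t.t$, with sorts $s\in\{\mathrm{TYPE},\mathrm{KIND}\}$, variables $x$, function symbols $f\in\mathbb{F}$. $\mathcal{R}$ is a set of rules $l\to r$, $l=f\,l_1\dots l_n$, $\mathrm{FV}(r)\subseteq\mathrm{FV}(l)$; $f$ is defined if it heads a rule, undefined otherwise. $\to_{\mathcal{R}}$ is the closure of $\mathcal{R}$ under substitution and context, $\to_\beta$ is $\beta$-reduction; $A\downarrow B$: common $\to^*$-reduct; $\mathrm{SN}$: terminating terms; ''$\to$ preserves typing'' means $\Gamma\vdash t:A$ and $t\to u$ imply $\Gamma\vdash u:A$; under local confluence each $t\in\mathrm{SN}$ has a unique normal form $t{\downarrow}$. Each $f$ has type $\Theta_f$ and sort $s_f$; $\mathrm{ar}(T)$ is the number of leading products of $T$; $\Gamma_f$ is the environment with $\Theta_f=\Pi\Gamma_f.U$, $|\Gamma_f|=\mathrm{ar}(\Theta_f)$. Typing $\vdash$: $\vdash\mathrm{TYPE}:\mathrm{KIND}$; (var) $\Gamma\vdash A:s$, $x\notin\mathrm{dom}\Gamma$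 $\Rightarrow$ $\Gamma,x{:}A\vdash x:A$; (weak) $\Gamma\vdash A:s$, $\Gamma\vdash b:B$, $x\notin\mathrm{dom}\Gamma$ $\Rightarrow$ $\Gamma,x{:}A\vdash b:B$; (prod) $\Gamma\vdash A:\mathrm{TYPE}$, $\Gamma,x{:}A\vdash B:s$ $\Rightarrow$ $\Gamma\vdash\Pi x{:}A.B:s$; (abs) $\Gamma,x{:}A\vdash b:B$, $\Gamma\vdash\Pi x{:}A.B:s$ $\Rightarrow$ $\Gamma\vdash\lambda x{:}A.b:\Pi x{:}A.B$; (app) $\Gamma\vdash t:\Pi x{:}A.B$, $\Gamma\vdash a:A$ $\Rightarrow$ $\Gamma\vdash t\,a:B[x\mapsto a]$; (conv) $\Gamma\vdash a:A$, $A\downarrow B$, $\Gamma\vdash B:s$ $\Rightarrow$ $\Gamma\vdash a:B$; (fun) $\vdash\Theta_f:s_f$ $\Rightarrow$ $\vdash f:\Theta_f$. Kinds: $K::=\mathrm{TYPE}\mid\Pi x{:}t.K$. Interpretation: $\Pi a\in P.Q(a)=\{t\mid\forall a\in P,\ t\,a\in Q(a)\}$; for a partial function $I$ from terms to sets of terms, $D(I)$ is the set of $T\in\mathrm{SN}$ such that whenever $T\to^*\Pi x{:}A.B$, $A\in\mathrm{dom}(I)$ and $B[x\mapsto a]\in\mathrm{dom}(I)$ for all $a\in I(A)$; $F(I)$ has domain $D(I)$, $F(I)(T)=\Pi a\in I(A).I(B[x\mapsto a])$ if $T{\downarrow}=\Pi x{:}A.B$, else $\mathrm{SN}$; $\mathcal{I}$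 is the least fixpoint of the monotone $F$, $\mathcal{D}=D(\mathcal{I})$. $[\![s]\!]_\sigma=\mathcal{D}$; $[\![\Pi x{:}A.K]\!]_\sigma=\Pi a\in[\![A]\!]_\sigma.[\![K]\!]_{[x\mapsto a,\sigma]}$ for $K$ a kind, $x\notin\mathrm{dom}\sigma$; $[\![T]\!]_\sigma=\mathcal{I}(T\sigma)$ if $T$ is not a kind nor $\mathrm{KIND}$ and $T\sigma\in\mathcal{D}$; otherwise $\mathrm{SN}$. $\sigma\models\Gamma$ iff $x\sigma\in[\![A]\!]_\sigma$ for all $(x{:}A)\in\Gamma$. $\mathbb{C}$ is the set of terms $f\,\vec t$ with $|\vec t|=\mathrm{ar}(\Theta_f)$, $\vdash\Theta_f:s_f$, $\Theta_f\in[\![s_f]\!]_{\mathrm{id}}$ and, if $\Gamma_f=\vec x{:}\vec A$, $[\vec x\mapsto\vec t]\models\Gamma_f$. Dependency pairs: $f\,\vec l>g\,\vec m$ iff there is a rule $f\,\vec l\to r$, $g$ is defined and $g\,\vec m$ is a subterm of $r$ with $\vec m$ all the arguments to which $g$ is applied. On $\mathbb{C}$: $f\,t_1\dots t_p\ \tilde{<}\ g\,u_1\dots u_q$ iff there are a dependency pair $f\,l_1\dots l_i>g\,m_1\dots m_j$ with $i\le p$, $j\le q$ and $\sigma$ with $t_k\to^*l_k\sigma$ ($k\le i$) and $m_k\sigma=u_k$ ($k\le j$). ''$\tilde{<}$ terminates'': no infinite $\tilde{<}$-chain. Well-structured: $\succeq$ is the smallest quasi-order on $\mathbb{F}$ with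 $f\succeq g$ if $g$ occurs in $\Theta_f$ or in the right-hand side of a rule headed by $f$; $\succ$ its strict part. $\vdash_{\prec f}$: the rules of $\vdash$ with (fun) replaced by: $\vdash_{\prec f}\Theta_g:s_g$, $g\prec f$ $\Rightarrow$ $\vdash_{\prec f}g:\Theta_g$. $\vdash_{f\vec l}$: $\vdash_{f\vec l}\mathrm{TYPE}:\mathrm{KIND}$; $\Gamma\vdash_{\prec f}A:s$, $x\notin\mathrm{dom}\Gamma$ $\Rightarrow$ $\Gamma,x{:}A\vdash_{f\vec l}x:A$; $\Gamma\vdash_{\prec f}A:s$, $\Gamma\vdash_{f\vec l}b:B$, $x\notin\mathrm{dom}\Gamma$ $\Rightarrow$ $\Gamma,x{:}A\vdash_{f\vec l}b:B$; $\Gamma\vdash_{f\vec l}A:\mathrm{TYPE}$, $\Gamma,x{:}A\vdash_{f\vec l}B:s$ $\Rightarrow$ $\Gamma\vdash_{f\vec l}\Pi x{:}A.B:s$; $\Gamma,x{:}A\vdash_{f\vec l}b:B$, $\Gamma\vdash_{\prec f}\Pi x{:}A.B:s$ $\Rightarrow$ $\Gamma\vdash_{f\vec l}\lambda x{:}A.b:\Pi x{:}A.B$; $\Gamma\vdash_{f\vec l}t:\Pi x{:}A.B$, $\Gamma\vdash_{f\vec l}a:A$, $\Gamma\vdash_{\prec f}\Pi x{:}A.B:s$ $\Rightarrow$ $\Gamma\vdash_{f\vec l}t\,a:B[x\mapsto a]$; $\Gamma\vdash_{f\vec l}a:A$, $A\downarrow B$, $\Gamma\vdash_{\prec f}B:s$,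 $\Gamma\vdash_{\prec f}A:s$ $\Rightarrow$ $\Gamma\vdash_{f\vec l}a:B$; (dp) if $\Theta_g=\Pi\vec y{:}\vec U.V$, $f\,\vec l>g\,\vec y\gamma$, $\vdash_{\prec f}\Theta_g:s_g$ and $\Gamma\vdash_{f\vec l}y_i\gamma:U_i\gamma$ for all $i$, then $\Gamma\vdash_{f\vec l}g\,\vec y\gamma:V\gamma$; (const) $g$ undefined, $\vdash_{\prec f}\Theta_g:s_g$ $\Rightarrow$ $\vdash_{f\vec l}g:\Theta_g$. $\mathcal{R}$ is well-structured if (a) $\succ$ is well-founded; (b) every rule $f\,\vec l\to r$ has $|\vec l|\le\mathrm{ar}(\Theta_f)$; (c) every dependency pair $f\,\vec l>g\,\vec m$ has $|\vec m|\le\mathrm{ar}(\Theta_g)$; (d) every rule $f\,\vec l\to r$ comes with an environment $\Delta_{f\vec l\to r}$ such that, if $\Theta_f=\Pi\vec x{:}\vec T.U$ with $|\vec x|=|\vec l|$ and $\pi=[\vec x\mapsto\vec l]$, then $\Delta_{f\vec l\to r}\vdash_{f\vec l}r:U\pi$. Accessible: a well-structured $\mathcal{R}$ is accessible if for all $\sigma$ and rules $f\,\vec l\to r$ with $\Theta_f=\Pi\vec x{:}\vec T.U$, $|\vec x|=|\vec l|$: $\sigma\models\Delta_{f\vec l\to r}$ whenever $\vdash\Theta_f:s_f$, $\Theta_f\in[\![s_f]\!]_{\mathrm{id}}$ and $[\vec x\mapsto\vec l]\sigma\models\vec x{:}\vec T$ (the substitution mapping $x_i$ to $l_i\sigma$).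 *)

(* Defs.v *)
From Stdlib Require Import List PeanoNat Relations.
Import ListNotations.
Set Implicit Arguments.
Unset Strict Implicit.
Unset Printing Implicit Defensive.

(** * Terms

    Terms modulo alpha-equivalence, as a nested datatype: [tm F V] is the type
    of terms with symbols in [F] and free variables in [V]; a binder adds one
    variable, [None].  The terms of the calculus are the [tm F name], and the
    usual named binders are [pi x A B] and [lam x A b] below. *)

Inductive sort := TYPE | KIND.

Inductive tm (F V : Type) : Type :=
| Srt (s : sort)
| Var (x : V)
| Fun (f : F)
| Pi  (A : tm F V) (B : tm F (option V))
| App (t u : tm F V)
| Lam (A : tm F V) (b : tm F (option V)).

Arguments Srt {F V} s.
Arguments Var {F V} x.
Arguments Fun {F V} f.

Fixpoint ren {F V W : Type} (h : V -> W) (t : tm F V) {struct t} : tm F W :=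
  match t with
  | Srt s => Srt s
  | Var x => Var (h x)
  | Fun f => Fun f
  | Pi A B => Pi (ren h A) (ren (option_map h) B)
  | App u v => App (ren h u) (ren h v)
  | Lam A b => Lam (ren h A) (ren (option_map h) b)
  end.

Definition up {F V W : Type} (sigma : V -> tm F W) (o : option V) : tm F (option W) :=
  match o with
  | Some x => ren (@Some W) (sigma x)
  | None => Var None
  end.

Fixpoint subst {F V W : Type} (sigma : V -> tm F W) (t : tm F V) {struct t} : tm F W :=
  match t with
  | Srt s => Srt s
  | Var x => sigma x
  | Fun f => Fun f
  | Pi A B => Pi (subst sigma A) (subst (up sigma) B)
  | App u v => App (subst sigma u) (subst sigma v)
  | Lam A b => Lam (subst sigma A) (subst (up sigma) b)
  end.

Definition scons {V T : Type} (a : T) (sigma : V -> T) (o : option V) : T :=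
  match o with
  | Some x => sigma x
  | None => a
  end.

Definition inst {F V : Type} (b : tm F (option V)) (a : tm F V) : tm F V :=
  subst (scons a Var) b.

Definition apps {F V : Type} (t : tm F V) (us : list (tm F V)) : tm F V :=
  fold_left (@App F V) us t.

Definition fapps {F V : Type} (f : F) (us : list (tm F V)) : tm F V :=
  apps (Fun f) us.

Fixpoint free {F V : Type} (x : V) (t : tm F V) {struct t} : Prop :=
  match t with
  | Var y => x = y
  | Pi A B => free x A \/ free (Some x) B
  | App u v => free x u \/ free x v
  | Lam A b => free x A \/ free (Some x) b
  | _ => False
  end.

Fixpoint sym_in {F V : Type} (f : F) (t : tm F V) {struct t} : Prop :=
  match t with
  | Fun g => f = g
  | Pi A B => sym_in f A \/ sym_in f B
  | App u v => sym_in f u \/ sym_in f v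
  | Lam A b => sym_in f A \/ sym_in f b
  | _ => False
  end.

Fixpoint is_kind {F V : Type} (t : tm F V) {struct t} : bool :=
  match t with
  | Srt TYPE => true
  | Pi _ K => is_kind K
  | _ => false
  end.

Fixpoint ar {F V : Type} (t : tm F V) {struct t} : nat :=
  match t with
  | Pi _ B => S (ar B)
  | _ => 0
  end.

Definition name := nat.
Definition term (F : Type) := tm F name.

Definition close {F : Type} (x : name) (t : term F) : tm F (option name) :=
  ren (fun y => if Nat.eqb y x then None else Some y) t.

Definition pi {F : Type} (x : name) (A B : term F) : term F := Pi A (close x B).
Definition lam {F : Type} (x : name) (A b : term F) : term F := Lam A (close x b).

(** Environments and telescopes are both lists of declarations.  In a typing
    environment the most recent declaration comes first; in a telescope the
    outermost product comes first. *)
Definition env (F : Type) := list (name * term F).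

Definition dom {F : Type} (Gamma : env F) : list name := map fst Gamma.

Fixpoint pis {F : Type} (G : env F) (U : term F) : term F :=
  match G with
  | [] => U
  | (x, A) :: G' => pi x A (pis G' U)
  end.

(** [T] is the product of [G] over [U], the names in [G] being chosen distinct
    from each other and from the free variables of [T]. *)
Definition telescope {F : Type} (T : term F) (G : env F) (U : term F) : Prop :=
  T = pis G U /\ NoDup (dom G) /\ forall x, In x (dom G) -> ~ free x T.

(** The simultaneous substitution mapping the i-th name to the i-th term, and
    any other variable to itself. *)
Fixpoint assign {F : Type} (xs : list name) (ts : list (term F)) (y : name) : term F :=
  match xs, ts with
  | x :: xs', t :: ts' => if Nat.eqb y x then t else assign xs' ts' y
  | _, _ => Var y
  end.

(** * Systems of symbols and rules *)

Record rule (F : Type) := Rule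
  { head : F; args : list (term F); rhs : term F }.

Definition lhs {F : Type} (rho : rule F) : term F := fapps (head rho) (args rho).

Record system := System
  { fsym : Type;
    Theta : fsym -> term fsym;
    sort_of : fsym -> sort;
    rules : rule fsym -> Prop;
    rules_free : forall rho, rules rho ->
      forall x, free x (rhs rho) -> free x (lhs rho) }.

Definition defined (S : system) (f : fsym S) : Prop :=
  exists rho, rules rho /\ head rho = f.

(** * Reduction *)

Inductive ctx {F : Type} (root : forall V : Type, tm F V -> tm F V -> Prop) :
  forall V : Type, tm F V -> tm F V -> Prop :=
| ctx_root V (t u : tm F V) : root V t u -> ctx root t u
| ctx_pi1 V (A A' : tm F V) B : ctx root A A' -> ctx root (Pi A B) (Pi A' B)
| ctx_pi2 V (A : tm F V) B B' : ctx root B B' -> ctx root (Pi A B) (Pi A B')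
| ctx_app1 V (t t' u : tm F V) : ctx root t t' -> ctx root (App t u) (App t' u)
| ctx_app2 V (t u u' : tm F V) : ctx root u u' -> ctx root (App t u) (App t u')
| ctx_lam1 V (A A' : tm F V) b : ctx root A A' -> ctx root (Lam A b) (Lam A' b)
| ctx_lam2 V (A : tm F V) b b' : ctx root b b' -> ctx root (Lam A b) (Lam A b').

Inductive beta_root {F : Type} (V : Type) : tm F V -> tm F V -> Prop :=
| Beta_root (A : tm F V) b a : beta_root (App (Lam A b) a) (inst b a).

Inductive rewrite_root (S : system) (V : Type) : tm (fsym S) V -> tm (fsym S) V -> Prop :=
| Rewrite_root rho (sigma : name -> tm (fsym S) V) :
    rules rho -> rewrite_root (subst sigma (lhs rho)) (subst sigma (rhs rho)).

Definition red (S : system) (V : Type) (t u : tm (fsym S) V) : Prop :=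
  ctx (@beta_root (fsym S)) t u \/ ctx (@rewrite_root S) t u.

Definition reds (S : system) (t u : term (fsym S)) : Prop :=
  clos_refl_trans _ (@red S name) t u.

Definition joinable (S : system) (t u : term (fsym S)) : Prop :=
  exists v, reds t v /\ reds u v.

Definition locally_confluent (S : system) : Prop :=
  forall t u v : term (fsym S), red t u -> red t v -> joinable u v.

Definition no_infinite_chain {X : Type} (R : X -> X -> Prop) (x : X) : Prop :=
  ~ exists s : nat -> X, s 0 = x /\ forall n, R (s n) (s (S n)).

Definition SN (S : system) (t : term (fsym S)) : Prop :=
  no_infinite_chain (@red S name) t.

Definition normal_form_of (S : system) (t u : term (fsym S)) : Prop :=
  reds t u /\ forall v, ~ red u v.

(** * Typing

    [typing ok] allows only the symbols satisfying [ok] in the rule for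
    symbols. *)

Inductive typing (S : system) (ok : fsym S -> Prop) :
  env (fsym S) -> term (fsym S) -> term (fsym S) -> Prop :=
| ty_sort : typing ok [] (Srt TYPE) (Srt KIND)
| ty_var Gamma x A s :
    typing ok Gamma A (Srt s) -> ~ In x (dom Gamma) ->
    typing ok ((x, A) :: Gamma) (Var x) A
| ty_weak Gamma x A s b B :
    typing ok Gamma A (Srt s) -> typing ok Gamma b B -> ~ In x (dom Gamma) ->
    typing ok ((x, A) :: Gamma) b B
| ty_prod Gamma x A B s :
    typing ok Gamma A (Srt TYPE) -> typing ok ((x, A) :: Gamma) B (Srt s) ->
    typing ok Gamma (pi x A B) (Srt s)
| ty_abs Gamma x A b B s :
    typing ok ((x, A) :: Gamma) b B -> typing ok Gamma (pi x A B) (Srt s) ->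
    typing ok Gamma (lam x A b) (pi x A B)
| ty_app Gamma t a A B :
    typing ok Gamma t (Pi A B) -> typing ok Gamma a A ->
    typing ok Gamma (App t a) (inst B a)
| ty_conv Gamma a A B s :
    typing ok Gamma a A -> joinable A B -> typing ok Gamma B (Srt s) ->
    typing ok Gamma a B
| ty_fun f :
    typing ok [] (Theta f) (Srt (sort_of f)) -> ok f ->
    typing ok [] (Fun f) (Theta f).

Definition typed (S : system) : env (fsym S) -> term (fsym S) -> term (fsym S) -> Prop :=
  typing (fun _ => True).

Definition preserves_typing (S : system) : Prop :=
  forall (Gamma : env (fsym S)) t u A,
    typed Gamma t A -> red t u -> typed Gamma u A.

(** * Interpretation of types

    A partial function from terms to sets of terms is given by its graph:
    [I T P] means that [T] is in the domain of [I] and that [I(T)] is [P]. *)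

Definition graph (F : Type) := term F -> (term F -> Prop) -> Prop.

Definition Dset (S : system) (I : graph (fsym S)) (T : term (fsym S)) : Prop :=
  SN T /\
  forall A B, reds T (Pi A B) ->
    exists P, I A P /\ forall a, P a -> exists Q, I (inst B a) Q.

Definition Pi_set {F : Type} (P : term F -> Prop) (Q : term F -> term F -> Prop)
  (t : term F) : Prop :=
  forall a, P a -> Q a (App t a).

(** All occurrences of [I] in [Fop I] are positive; on graphs of functions,
    the sets [PA] and [Q a] below are [I(A)] and [I(B[a])]. *)
Definition Fop (S : system) (I : graph (fsym S)) : graph (fsym S) :=
  fun T P => Dset I T /\
    ((exists A B PA Q,
        normal_form_of T (Pi A B) /\ I A PA /\
        (forall a, PA a -> I (inst B a) (Q a)) /\
        forall t, P t <-> Pi_set PA Q t)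
     \/ ((~ exists A B, normal_form_of T (Pi A B)) /\ forall t, P t <-> SN t)).

(** Least fixpoint of [Fop] for inclusion of graphs. *)
Definition interp (S : system) : graph (fsym S) :=
  fun T P => forall I : graph (fsym S),
    (forall T' P', Fop I T' P' -> I T' P') -> I T P.

Definition Dcal (S : system) (T : term (fsym S)) : Prop := Dset (@interp S) T.

Definition in_interp (S : system) (T t : term (fsym S)) : Prop :=
  exists P, interp T P /\ P t.

Definition sem_type (S : system) (T t : term (fsym S)) : Prop :=
  (Dcal T /\ in_interp T t) \/ (~ Dcal T /\ SN t).

Fixpoint sem (S : system) (V : Type) (T : tm (fsym S) V) (sigma : V -> term (fsym S))
  {struct T} : term (fsym S) -> Prop :=
  match T with
  | Srt _ => @Dcal S
  | Pi A K =>
      if is_kind K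
      then Pi_set (sem A sigma) (fun a => sem K (scons a sigma))
      else sem_type (subst sigma (Pi A K))
  | _ => sem_type (subst sigma T)
  end.

Definition models (S : system) (sigma : name -> term (fsym S))
  (Gamma : env (fsym S)) : Prop :=
  forall x A, In (x, A) Gamma -> sem A sigma (sigma x).

Definition Cset (S : system) (t : term (fsym S)) : Prop :=
  exists f ts,
    t = fapps f ts /\
    length ts = ar (Theta f) /\
    typed [] (Theta f) (Srt (sort_of f)) /\
    sem (Srt (sort_of f)) (@Var _ name) (Theta f) /\
    forall G U, telescope (Theta f) G U -> length G = ar (Theta f) ->
      models (assign (dom G) ts) G.

(** * Dependency pairs

    [call_in avoid g ms us t]: in [t us], the symbol [g] occurs inside [t] and
    [ms] are all the arguments to which this occurrence is applied.  Bound
    variables are given names outside [avoid]. *)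

Inductive call_in {F : Type} (avoid : name -> Prop) (g : F) (ms : list (term F)) :
  list (term F) -> term F -> Prop :=
| call_fun : call_in avoid g ms ms (Fun g)
| call_app1 us t u :
    call_in avoid g ms (u :: us) t -> call_in avoid g ms us (App t u)
| call_app2 us t u :
    call_in avoid g ms [] u -> call_in avoid g ms us (App t u)
| call_pi1 us A B :
    call_in avoid g ms [] A -> call_in avoid g ms us (Pi A B)
| call_pi2 us x A B :
    ~ avoid x -> call_in avoid g ms [] B -> call_in avoid g ms us (pi x A B)
| call_lam1 us A b :
    call_in avoid g ms [] A -> call_in avoid g ms us (Lam A b)
| call_lam2 us x A b :
    ~ avoid x -> call_in avoid g ms [] b -> call_in avoid g ms us (lam x A b).

Definition dep_pair (S : system) (f : fsym S) (ls : list (term (fsym S)))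
  (g : fsym S) (ms : list (term (fsym S))) : Prop :=
  exists r, rules (Rule f ls r) /\ defined g /\
    call_in (fun x => free x (fapps f ls)) g ms [] r.

Definition call (S : system) (t u : term (fsym S)) : Prop :=
  Cset t /\ Cset u /\
  exists f ts g us ls ms (sigma : name -> term (fsym S)),
    t = fapps f ts /\ u = fapps g us /\ dep_pair f ls g ms /\
    length ls <= length ts /\ length ms <= length us /\
    Forall2 (fun t l => reds t (subst sigma l)) (firstn (length ls) ts) ls /\
    Forall2 (fun m u => subst sigma m = u) ms (firstn (length ms) us).

Definition call_terminates (S : system) : Prop :=
  forall t, no_infinite_chain (@call S) t.

(** * Well-structured and accessible systems *)

Definition geq (S : system) : fsym S -> fsym S -> Prop :=
  clos_refl_trans _ (fun f g =>
    sym_in g (Theta f) \/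
    exists rho, rules rho /\ head rho = f /\ sym_in g (rhs rho)).

Definition gt (S : system) (f g : fsym S) : Prop := geq f g /\ ~ geq g f.

Definition typed_lt (S : system) (f : fsym S) :
  env (fsym S) -> term (fsym S) -> term (fsym S) -> Prop :=
  typing (gt f).

(** Side condition of [tc_prod] and [tc_abs]: as usual with named variables,
    a variable bound in the right-hand side of a rule is chosen distinct from
    the variables of the rule. *)
Inductive typed_call (S : system) (f : fsym S) (ls : list (term (fsym S))) :
  env (fsym S) -> term (fsym S) -> term (fsym S) -> Prop :=
| tc_sort : typed_call f ls [] (Srt TYPE) (Srt KIND)
| tc_var Gamma x A s :
    typed_lt f Gamma A (Srt s) -> ~ In x (dom Gamma) ->
    typed_call f ls ((x, A) :: Gamma) (Var x) A
| tc_weak Gamma x A s b B :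
    typed_lt f Gamma A (Srt s) -> typed_call f ls Gamma b B ->
    ~ In x (dom Gamma) ->
    typed_call f ls ((x, A) :: Gamma) b B
| tc_prod Gamma x A B s :
    ~ free x (fapps f ls) ->
    typed_call f ls Gamma A (Srt TYPE) ->
    typed_call f ls ((x, A) :: Gamma) B (Srt s) ->
    typed_call f ls Gamma (pi x A B) (Srt s)
| tc_abs Gamma x A b B s :
    ~ free x (fapps f ls) ->
    typed_call f ls ((x, A) :: Gamma) b B ->
    typed_lt f Gamma (pi x A B) (Srt s) ->
    typed_call f ls Gamma (lam x A b) (pi x A B)
| tc_app Gamma t a A B s :
    typed_call f ls Gamma t (Pi A B) -> typed_call f ls Gamma a A ->
    typed_lt f Gamma (Pi A B) (Srt s) ->
    typed_call f ls Gamma (App t a) (inst B a)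
| tc_conv Gamma a A B s :
    typed_call f ls Gamma a A -> joinable A B ->
    typed_lt f Gamma B (Srt s) -> typed_lt f Gamma A (Srt s) ->
    typed_call f ls Gamma a B
| tc_dp Gamma g G V (gamma : name -> term (fsym S)) :
    telescope (Theta g) G V ->
    dep_pair f ls g (map gamma (dom G)) ->
    typed_lt f [] (Theta g) (Srt (sort_of g)) ->
    (forall y U, In (y, U) G -> typed_call f ls Gamma (gamma y) (subst gamma U)) ->
    typed_call f ls Gamma (fapps g (map gamma (dom G))) (subst gamma V)
| tc_const g :
    ~ defined g ->
    typed_lt f [] (Theta g) (Srt (sort_of g)) ->
    typed_call f ls [] (Fun g) (Theta g).

Definition well_structured (S : system) (Delta : rule (fsym S) -> env (fsym S)) : Prop :=
  well_founded (fun g f : fsym S => gt f g) /\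
  (forall rho : rule (fsym S), rules rho ->
     length (args rho) <= ar (Theta (head rho))) /\
  (forall (f : fsym S) ls g ms, dep_pair f ls g ms ->
     length ms <= ar (Theta g)) /\
  (forall rho : rule (fsym S), rules rho ->
     forall G U, telescope (Theta (head rho)) G U ->
       length G = length (args rho) ->
       typed_call (head rho) (args rho) (Delta rho) (rhs rho)
         (subst (assign (dom G) (args rho)) U)).

Definition accessible (S : system) (Delta : rule (fsym S) -> env (fsym S)) : Prop :=
  forall (sigma : name -> term (fsym S)) rho, rules rho ->
    forall G U, telescope (Theta (head rho)) G U ->
      length G = length (args rho) ->
      typed [] (Theta (head rho)) (Srt (sort_of (head rho))) ->
      sem (Srt (sort_of (head rho))) (@Var _ name) (Theta (head rho)) ->
      models (assign (dom G) (map (subst sigma) (args rho))) G ->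
      models sigma (Delta rho).

(* Main.v *)
From Stdlib Require Import List PeanoNat Lia Relations Operators_Properties.
From Stdlib Require Import Classical ClassicalEpsilon.
Require Import Defs.
Import ListNotations.
Set Implicit Arguments.
Unset Strict Implicit.

(** A typable term belongs to the interpretation of its type (adequacy), and these
    interpretations are reducibility candidates, hence sets of terminating terms.
    Adequacy reduces to the membership of every symbol [f] in the interpretation of
    its type, which is proved by induction on the precedence.  As [f] applied to as
    many arguments as its type has products is neutral, one has to consider its
    reducts only, by induction on the calls and then on the reduction of the
    arguments.  A reduct at the root is an instance of the right-hand side of a
    rule; accessibility makes the instantiating substitution a model of the
    environment of the rule, and adequacy for [typed_call] concludes, its rule for
    dependency pairs producing exactly the calls covered by the induction. *)

(** * Substitution *)

(** A sort has two interpretations: [sem] gives it [Dcal], while [interp] gives it the set of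
    terminating terms. A type that is not a kind may become one under a model, since a variable of
    type [TYPE] may be mapped to a sort, a member of [Dcal]. The interpretation of an instance is
    thus not determined by the instance alone. Hence [arity_sem] keeps, beside the instance, two
    data of the original type: kind or not, and number of products. Typed substitutions and
    conversion preserve kinds, because kinds are exactly the terms of type [KIND]; preservation of
    typing enters there. The left-hand side of a rule is not known to be typable, so that matching
    may turn a type into a kind; the inclusion of [Dcal] in the terminating terms then suffices.
    Local confluence enters through the uniqueness of normal forms of terminating terms, which makes
    [interp] single-valued and invariant under reduction. *)

Lemma ren_ext (F V W : Type) (t : tm F V) (g h : V -> W) :
  (forall x, g x = h x) -> ren g t = ren h t.
Proof.
revert W g h.
induction t; intros W g h E; simpl; f_equal; auto;
  match goal with H : forall W g h, _ -> _ = _ |- _ => apply H end;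
  intros [x|]; simpl; congruence.
Qed.

Lemma ren_ren (F V W X : Type) (t : tm F V) (g : V -> W) (h : W -> X) :
  ren h (ren g t) = ren (fun x => h (g x)) t.
Proof.
revert W X g h.
induction t; intros W X g h; simpl; f_equal; auto;
  match goal with H : forall W X g h, _ = _ |- _ => rewrite H end;
  apply ren_ext; intros [x|]; reflexivity.
Qed.

Lemma subst_ext_free (F V W : Type) (t : tm F V) (sigma tau : V -> tm F W) :
  (forall x, free x t -> sigma x = tau x) -> subst sigma t = subst tau t.
Proof.
revert W sigma tau.
induction t; intros W sigma tau E; simpl in *; f_equal; auto;
  match goal with H : forall W g h, _ -> _ = subst _ ?u |- _ = subst _ ?u => apply H end;
  intros [x|] Hx; simpl; auto; rewrite E; auto.
Qed.

Lemma subst_ext (F V W : Type) (t : tm F V) (sigma tau : V -> tm F W) :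
  (forall x, sigma x = tau x) -> subst sigma t = subst tau t.
Proof. intros E; apply subst_ext_free; auto. Qed.

Lemma subst_ren (F V W X : Type) (t : tm F V) (h : V -> W) (sigma : W -> tm F X) :
  subst sigma (ren h t) = subst (fun x => sigma (h x)) t.
Proof.
revert W X h sigma.
induction t; intros W X h sigma; simpl; f_equal; auto;
  match goal with H : forall W X g h, _ = _ |- _ => rewrite H end;
  apply subst_ext; intros [x|]; reflexivity.
Qed.

Lemma ren_subst (F V W X : Type) (t : tm F V) (sigma : V -> tm F W) (h : W -> X) :
  ren h (subst sigma t) = subst (fun x => ren h (sigma x)) t.
Proof.
revert W X h sigma.
induction t; intros W X h sigma; simpl; f_equal; auto;
  match goal with H : forall W X g h, _ = _ |- _ => rewrite H end;
  apply subst_ext; intros [x|]; simpl; auto; rewrite !ren_ren; reflexivity.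
Qed.

Lemma subst_subst (F V W X : Type) (t : tm F V) (sigma : V -> tm F W) (tau : W -> tm F X) :
  subst tau (subst sigma t) = subst (fun x => subst tau (sigma x)) t.
Proof.
revert W X sigma tau.
induction t; intros W X sigma tau; simpl; f_equal; auto;
  match goal with H : forall W X g h, _ = _ |- _ => rewrite H end;
  apply subst_ext; intros [x|]; simpl; auto; rewrite subst_ren, ren_subst; reflexivity.
Qed.

Lemma subst_id (F V : Type) (t : tm F V) (sigma : V -> tm F V) :
  (forall x, free x t -> sigma x = Var x) -> subst sigma t = t.
Proof.
revert sigma.
induction t; intros sigma E; simpl in *; f_equal; auto;
  match goal with H : forall s, _ -> subst _ ?u = _ |- subst _ ?u = _ => apply H end;
  intros [x|] Hx; simpl; auto; rewrite E; auto.
Qed.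

Lemma ren_as_subst (F V W : Type) (t : tm F V) (h : V -> W) :
  ren h t = subst (fun x => Var (h x)) t.
Proof.
rewrite <- (subst_id (t := ren h t) (sigma := Var)), subst_ren; auto.
Qed.

Lemma inst_up (F V W : Type) (B : tm F (option V)) (sigma : V -> tm F W) a :
  inst (subst (up sigma) B) a = subst (scons a sigma) B.
Proof.
unfold inst; rewrite subst_subst; apply subst_ext; intros [x|]; simpl; auto.
rewrite subst_ren; apply subst_id; auto.
Qed.

Lemma subst_inst (F V W : Type) (B : tm F (option V)) (sigma : V -> tm F W) a :
  subst sigma (inst B a) = subst (scons (subst sigma a) sigma) B.
Proof.
unfold inst; rewrite subst_subst; apply subst_ext; intros [x|]; simpl; auto.
Qed.

Lemma subst_apps (F V W : Type) (sigma : V -> tm F W) (t : tm F V) us :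
  subst sigma (apps t us) = apps (subst sigma t) (map (subst sigma) us).
Proof. revert t; induction us; intros t; simpl; auto. Qed.

Lemma subst_fapps (F V W : Type) (sigma : V -> tm F W) (f : F) us :
  subst sigma (fapps f us) = fapps f (map (subst sigma) us).
Proof. apply subst_apps. Qed.

Lemma apps_app (F V : Type) (t : tm F V) us vs : apps t (us ++ vs) = apps (apps t us) vs.
Proof. apply fold_left_app. Qed.

Lemma free_apps (F V : Type) (x : V) (t : tm F V) us :
  free x (apps t us) <-> free x t \/ exists u, In u us /\ free x u.
Proof.
revert t; induction us as [|u us IH]; intros t; simpl.
- split; [auto | intros [H|[u [[] _]]]; auto].
- rewrite IH; simpl; split.
  + intros [[H|H]|[v [H1 H2]]]; eauto.
  + intros [H|[v [[->|H1] H2]]]; eauto.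
Qed.

Lemma fapps_inj (F V : Type) (f g : F) (ts us : list (tm F V)) :
  fapps f ts = fapps g us -> f = g /\ ts = us.
Proof.
revert us; induction ts as [|t ts IH] using rev_ind;
  intros us; destruct us as [|u us _] using rev_ind;
  unfold fapps; rewrite ?apps_app; simpl; intros E.
- injection E as ->; auto.
- discriminate.
- discriminate.
- injection E as E ->.
  destruct (IH _ E) as [-> ->]; auto.
Qed.

Lemma app_fapps (F V : Type) (t a : tm F V) f ts :
  App t a = fapps f ts -> exists us, ts = us ++ [a] /\ t = fapps f us.
Proof.
destruct ts as [|u us _] using rev_ind; unfold fapps.
- discriminate.
- rewrite apps_app; simpl; intros E; injection E as -> ->; eauto.
Qed.

Definition upd {T : Type} (sigma : name -> T) (x : name) (a : T) (y : name) : T :=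
  if Nat.eqb y x then a else sigma y.

Lemma upd_same (T : Type) (sigma : name -> T) x a : upd sigma x a x = a.
Proof. unfold upd; now rewrite Nat.eqb_refl. Qed.

Lemma upd_other (T : Type) (sigma : name -> T) x a y : y <> x -> upd sigma x a y = sigma y.
Proof. intros H; unfold upd; apply Nat.eqb_neq in H; now rewrite H. Qed.

Lemma scons_close (F W : Type) (sigma : name -> tm F W) x a (B : term F) :
  subst (scons a sigma) (close x B) = subst (upd sigma x a) B.
Proof.
unfold close; rewrite subst_ren; apply subst_ext; intros y; unfold upd.
destruct (Nat.eqb y x); reflexivity.
Qed.

Lemma inst_close (F : Type) x a (B : term F) : inst (close x B) a = subst (upd Var x a) B.
Proof. apply scons_close. Qed.

Lemma inst_close_same (F : Type) x (B : term F) : inst (close x B) (Var x) = B.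
Proof.
rewrite inst_close; apply subst_id; intros y _; unfold upd.
destruct (Nat.eqb_spec y x); congruence.
Qed.

Lemma free_ren (F V W : Type) (h : V -> W) (t : tm F V) y :
  free y (ren h t) <-> exists x, y = h x /\ free x t.
Proof.
revert W h y; induction t; intros W h y; simpl.
- split; [intros [] | intros [x [_ []]]].
- split; [intros ->; eauto | intros [z [-> ->]]; auto].
- split; [intros [] | intros [x [_ []]]].
- rewrite IHt1, IHt2; split.
  + intros [[x [-> H]]|[[x|] [E H]]]; [eauto | injection E as ->; eauto | discriminate].
  + intros [x [-> [H|H]]]; [eauto | right; exists (Some x); auto].
- rewrite IHt1, IHt2; split.
  + intros [[x [-> H]]|[x [-> H]]]; eauto.
  + intros [x [-> [H|H]]]; eauto.
- rewrite IHt1, IHt2; split.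
  + intros [[x [-> H]]|[[x|] [E H]]]; [eauto | injection E as ->; eauto | discriminate].
  + intros [x [-> [H|H]]]; [eauto | right; exists (Some x); auto].
Qed.

Lemma free_close (F : Type) x y (B : term F) :
  free (Some y) (close x B) <-> y <> x /\ free y B.
Proof.
unfold close; rewrite free_ren; split.
- intros [z [E H]]; destruct (Nat.eqb_spec z x); try discriminate.
  injection E as ->; auto.
- intros [H1 H2]; exists y; apply Nat.eqb_neq in H1; rewrite H1; auto.
Qed.

Lemma free_subst (F V W : Type) (sigma : V -> tm F W) (t : tm F V) y :
  free y (subst sigma t) -> exists x, free x t /\ free y (sigma x).
Proof.
revert W sigma y; induction t; intros W sigma y; simpl; try (intros []; fail); eauto.
- intros [H|H].
  + apply IHt1 in H as [x [? ?]]; eauto.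
  + apply IHt2 in H as [[x|] [H1 H2]]; simpl in H2; [|discriminate].
    apply free_ren in H2 as [w [E H2]]; injection E as ->; eauto.
- intros [H|H]; [apply IHt1 in H as [x [? ?]] | apply IHt2 in H as [x [? ?]]]; eauto.
- intros [H|H].
  + apply IHt1 in H as [x [? ?]]; eauto.
  + apply IHt2 in H as [[x|] [H1 H2]]; simpl in H2; [|discriminate].
    apply free_ren in H2 as [w [E H2]]; injection E as ->; eauto.
Qed.

Lemma free_finite (F V : Type) (t : tm F V) : exists l, forall x, free x t -> In x l.
Proof.
assert (U : forall (V : Type) (l : list (option V)),
  exists l', forall x, In (Some x) l -> In x l').
{ intros W l; exists (flat_map (fun o => match o with Some x => [x] | None => [] end) l).
  intros x H; apply in_flat_map; exists (Some x); simpl; auto. }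
induction t; simpl; try (exists []; intros ? []; fail).
- exists [x]; simpl; auto.
- destruct IHt1 as [l1 H1], IHt2 as [l2 H2], (U _ l2) as [l3 H3].
  exists (l1 ++ l3); intros x [H|H]; apply in_or_app; auto.
- destruct IHt1 as [l1 H1], IHt2 as [l2 H2].
  exists (l1 ++ l2); intros x [H|H]; apply in_or_app; auto.
- destruct IHt1 as [l1 H1], IHt2 as [l2 H2], (U _ l2) as [l3 H3].
  exists (l1 ++ l3); intros x [H|H]; apply in_or_app; auto.
Qed.

Lemma list_bounded (l : list name) : exists N, forall x, In x l -> x < N.
Proof.
exists (S (list_max l)); intros x H.
assert (Hm := proj1 (list_max_le l _) (le_n _)).
rewrite Forall_forall in Hm; specialize (Hm x H); lia.
Qed.

Lemma free_bounded (F : Type) (t : term F) : exists N, forall x, free x t -> x < N.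
Proof.
destruct (free_finite t) as [l H], (list_bounded l) as [N H']; exists N; auto.
Qed.

(** The new bound name has to avoid only the images of the free variables of the abstraction. Any
    name fresh for the target environment will do, whatever names [B] uses. *)
Lemma subst_close (F : Type) (sigma : name -> term F) x y (B : term F) :
  (forall z, free (Some z) (close x B) -> ~ free y (sigma z)) ->
  subst (up sigma) (close x B) = close y (subst (upd sigma x (Var y)) B).
Proof.
intros H; unfold close at 2.
rewrite ren_subst; unfold close; rewrite subst_ren.
apply subst_ext_free; intros z Hz; unfold upd.
destruct (Nat.eqb_spec z x) as [->|n]; simpl; [now rewrite Nat.eqb_refl|].
rewrite !ren_as_subst; apply subst_ext_free; intros w Hw.
destruct (Nat.eqb_spec w y) as [->|m]; auto.
exfalso; apply (H z); auto; apply free_close; auto.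
Qed.

Lemma subst_pi (F : Type) (sigma : name -> term F) x y (A B : term F) :
  (forall z, free z (pi x A B) -> ~ free y (sigma z)) ->
  subst sigma (pi x A B) = pi y (subst sigma A) (subst (upd sigma x (Var y)) B).
Proof.
intros H; unfold pi; simpl; f_equal; apply subst_close.
intros z Hz; apply H; simpl; auto.
Qed.

Lemma subst_lam (F : Type) (sigma : name -> term F) x y (A b : term F) :
  (forall z, free z (lam x A b) -> ~ free y (sigma z)) ->
  subst sigma (lam x A b) = lam y (subst sigma A) (subst (upd sigma x (Var y)) b).
Proof.
intros H; unfold lam; simpl; f_equal; apply subst_close.
intros z Hz; apply H; simpl; auto.
Qed.

(** * Kinds and arities *)

Lemma is_kind_ren (F V W : Type) (h : V -> W) (t : tm F V) : is_kind (ren h t) = is_kind t.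
Proof. revert W h; induction t; intros; simpl; auto. Qed.

Lemma is_kind_close (F : Type) x (t : term F) : is_kind (close x t) = is_kind t.
Proof. apply is_kind_ren. Qed.

Lemma ar_ren (F V W : Type) (h : V -> W) (t : tm F V) : ar (ren h t) = ar t.
Proof. revert W h; induction t; intros; simpl; auto. Qed.

Lemma is_kind_subst (F V W : Type) (sigma : V -> tm F W) (t : tm F V) :
  is_kind t = true -> is_kind (subst sigma t) = true /\ ar (subst sigma t) = ar t.
Proof.
revert W sigma; induction t; intros W sigma; simpl; try discriminate; auto.
intros H; destruct (IHt2 _ (up sigma) H); auto.
Qed.

Lemma ar_subst (F V W : Type) (sigma : V -> tm F W) (t : tm F V) :
  ar t <= ar (subst sigma t).
Proof.
revert W sigma; induction t; intros W sigma; simpl; try lia.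
specialize (IHt2 _ (up sigma)); lia.
Qed.

(** A kind or [KIND]: the types whose interpretation is not given by [interp]. *)
Definition kd {F V : Type} (t : tm F V) : bool :=
  match t with
  | Srt _ => true
  | _ => is_kind t
  end.

Lemma is_kind_kd (F V : Type) (t : tm F V) : is_kind t = true -> kd t = true.
Proof. destruct t; simpl; auto. Qed.

Lemma kd_ren (F V W : Type) (h : V -> W) (t : tm F V) : kd (ren h t) = kd t.
Proof. destruct t; simpl; auto; apply is_kind_ren. Qed.

(** Typable kinds satisfy this condition, under which [sem] interprets the domains
    of a kind through [interp]. *)
Fixpoint wk {F V : Type} (t : tm F V) {struct t} : Prop :=
  match t with
  | Pi A K => is_kind K = true -> kd A = false /\ wk K
  | _ => True
  end.

Lemma wk_ren (F V W : Type) (h : V -> W) (t : tm F V) : wk t -> wk (ren h t).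
Proof.
revert W h; induction t; intros W h; simpl; auto.
rewrite is_kind_ren, kd_ren; intros H E; destruct (H E); auto.
Qed.

(** In a typing judgment [KIND] can only be the whole type. On terms without it, [kd] and [is_kind]
    agree. *)
Fixpoint kindless {F V : Type} (t : tm F V) {struct t} : Prop :=
  match t with
  | Srt KIND => False
  | Pi A B | Lam A B => kindless A /\ kindless B
  | App u v => kindless u /\ kindless v
  | _ => True
  end.

Lemma kindless_ren (F V W : Type) (h : V -> W) (t : tm F V) :
  kindless (ren h t) <-> kindless t.
Proof.
revert W h; induction t; intros W h; simpl; try tauto.
all: rewrite IHt1, IHt2; tauto.
Qed.

Lemma kindless_subst (F V W : Type) (sigma : V -> tm F W) (t : tm F V) :
  kindless t -> (forall x, kindless (sigma x)) -> kindless (subst sigma t).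
Proof.
revert W sigma; induction t; intros W sigma; simpl; auto.
- intros [H1 H2] H; split; auto; apply IHt2; auto.
  intros [x|]; simpl; auto; now apply kindless_ren.
- intros [H1 H2] H; split; auto.
- intros [H1 H2] H; split; auto; apply IHt2; auto.
  intros [x|]; simpl; auto; now apply kindless_ren.
Qed.

Lemma kindless_inst (F V : Type) (B : tm F (option V)) a :
  kindless B -> kindless a -> kindless (inst B a).
Proof.
intros H1 H2; apply kindless_subst; auto; intros [x|]; simpl; auto.
Qed.

Lemma kindless_kd (F V : Type) (t : tm F V) : kindless t -> kd t = is_kind t.
Proof. destruct t as [[]| | | | |]; simpl; tauto. Qed.

(** * Telescopes *)

Lemma ar_pis (F : Type) (G : env F) U : ar (pis G U) = length G + ar U.
Proof.
induction G as [|[x A] G IH]; simpl; auto; f_equal.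
exact (eq_trans (ar_ren _ _) IH).
Qed.

Lemma is_kind_pis (F : Type) (G : env F) U : is_kind (pis G U) = is_kind U.
Proof.
induction G as [|[x A] G IH]; simpl; auto.
now rewrite is_kind_close.
Qed.

Lemma telescope_exists (F : Type) n (T : term F) :
  n <= ar T -> exists G U, telescope T G U /\ length G = n.
Proof.
(* [N] bounds the free variables of the current type, and the names chosen are [N], [N + 1] and so
   on: increasing, hence distinct and fresh. *)
enough (H : forall N (T : term F), n <= ar T -> (forall x, free x T -> x < N) ->
  exists G U, telescope T G U /\ length G = n /\ forall x, In x (dom G) -> N <= x).
{ intros Hn; destruct (free_bounded T) as [N HN].
  destruct (H N T Hn HN) as (G & U & ? & ? & _); eauto. }
clear T; induction n as [|n IH]; intros N T Hn HN.
- exists [], T; repeat split; simpl; auto; try (intros ? []); constructor.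
- destruct T as [| | |A B| |]; simpl in Hn; try lia.
  assert (HB : forall x, free x (inst B (Var N)) -> x < S N).
  { intros x Hx; apply free_subst in Hx as [[y|] [H1 H2]]; simpl in H2; subst; auto.
    enough (y < N) by lia; apply HN; simpl; auto. }
  assert (EB : B = close N (inst B (Var N))).
  { unfold inst, close; rewrite ren_subst; symmetry; apply subst_id.
    intros [y|] Hy; simpl; [|now rewrite Nat.eqb_refl].
    destruct (Nat.eqb_spec y N); auto; subst.
    enough (N < N) by lia; apply HN; simpl; auto. }
  destruct (IH (S N) (inst B (Var N))) as (G & U & (E & Nd & Fr) & El & Hd); auto.
  { enough (ar B <= ar (inst B (Var N))) by lia; apply ar_subst. }
  exists ((N, A) :: G), U; repeat split; simpl; auto.
  + unfold pi; rewrite <- E, <- EB; auto.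
  + constructor; auto; intros Hi; apply Hd in Hi; lia.
  + intros x [<-|Hx] Hf; apply HN in Hf; [lia|]; apply Hd in Hx; lia.
  + intros x [<-|Hx]; auto; apply Hd in Hx; lia.
Qed.

Lemma map_assign (F : Type) (xs : list name) (ts : list (term F)) :
  NoDup xs -> length xs = length ts -> map (assign xs ts) xs = ts.
Proof.
revert ts; induction xs as [|x xs IH]; intros [|t ts] H E; simpl in *; try discriminate; auto.
inversion H; subst; rewrite Nat.eqb_refl; f_equal.
transitivity (map (assign xs ts) xs); auto.
apply map_ext_in; intros y Hy; destruct (Nat.eqb_spec y x); congruence.
Qed.

Lemma assign_map (F : Type) (xs : list name) (ts : list (term F)) (sigma : name -> term F) y :
  length xs = length ts -> In y xs ->
  assign xs (map (subst sigma) ts) y = subst sigma (assign xs ts y).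
Proof.
revert ts; induction xs as [|x xs IH]; intros [|t ts] E H; simpl in *; try discriminate; [tauto|].
destruct (Nat.eqb_spec y x); auto; destruct H as [->|]; [congruence|]; auto.
Qed.

(** Instantiating at the value that [sigma] already gives to [x] leaves [sigma] unchanged, so a
    whole telescope can be traversed with a single substitution and no freshness condition. *)
Lemma inst_pis (F : Type) (G : env F) x V (sigma : name -> term F) :
  inst (subst (up sigma) (close x (pis G V))) (sigma x) = subst sigma (pis G V).
Proof.
rewrite inst_up, scons_close; apply subst_ext; intros y; unfold upd.
destruct (Nat.eqb_spec y x); congruence.
Qed.


(** * Reduction *)

Lemma no_infinite_chain_Acc (X : Type) (R : X -> X -> Prop) x :
  no_infinite_chain R x <-> Acc (fun v u => R u v) x.
Proof.
split.
- intros H; apply NNPP; intros Hx; apply H; clear H.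
  (* Classically, an element that is not accessible has a successor that is not accessible either;
     choice strings these successors into an infinite chain. *)
  pose (bad := {y | ~ Acc (fun v u => R u v) y}).
  assert (next : forall y : bad, {z : bad | R (proj1_sig y) (proj1_sig z)}).
  { intros [y Hy]; apply constructive_indefinite_description; apply NNPP; intros H.
    apply Hy; constructor; intros z Hz; apply NNPP; intros Hz'.
    apply H; exists (exist _ z Hz'); auto. }
  pose (s := nat_rect (fun _ => bad) (exist _ x Hx) (fun _ y => proj1_sig (next y))).
  exists (fun n => proj1_sig (s n)); split; auto.
  intros n; exact (proj2_sig (next (s n))).
- induction 1 as [x _ IH]; intros [s [E Hs]].
  apply (IH (s 1)); [rewrite <- E; auto|].
  exists (fun n => s (S n)); auto.
Qed.

Lemma Acc_clos_rt (X : Type) (R : X -> X -> Prop) x y :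
  clos_refl_trans _ R x y -> Acc (fun v u => R u v) x -> Acc (fun v u => R u v) y.
Proof. induction 1; auto. intros [H']; auto. Qed.

Lemma Acc_preimage (X Y : Type) (R : X -> X -> Prop) (T : Y -> Y -> Prop) (h : X -> Y) x :
  (forall u v, R u v -> T (h u) (h v)) ->
  Acc (fun v u => T u v) (h x) -> Acc (fun v u => R u v) x.
Proof.
intros Hh H; remember (h x) as y; revert x Heqy.
induction H as [y _ IH]; intros x ->; constructor; intros z Hz; eauto.
Qed.

Lemma clos_rt_map (X Y : Type) (R : X -> X -> Prop) (T : Y -> Y -> Prop) (h : X -> Y) x y :
  (forall u v, R u v -> T (h u) (h v)) ->
  clos_refl_trans _ R x y -> clos_refl_trans _ T (h x) (h y).
Proof.
intros H; induction 1.
- apply rt_step; auto.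
- apply rt_refl.
- eapply rt_trans; eauto.
Qed.

Lemma Acc_normal_form (X : Type) (R : X -> X -> Prop) x :
  Acc (fun v u => R u v) x -> exists y, clos_refl_trans _ R x y /\ forall z, ~ R y z.
Proof.
induction 1 as [x _ IH].
destruct (classic (exists y, R x y)) as [[y Hy]|Hn].
- destruct (IH y Hy) as (z & H1 & H2); exists z; split; auto.
  eapply rt_trans; [apply rt_step|]; eauto.
- exists x; split; [apply rt_refl|]; intros z Hz; eauto.
Qed.

(** Newman's lemma with termination of [x] only: the first steps of the two reductions are joined at
    [w], and a normal form of [w] is equal to [y] and to [z] by induction. *)
Lemma newman (X : Type) (R : X -> X -> Prop) x :
  (forall t u v, R t u -> R t v ->
     exists w, clos_refl_trans _ R u w /\ clos_refl_trans _ R v w) ->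
  Acc (fun v u => R u v) x -> forall y z,
  clos_refl_trans _ R x y -> clos_refl_trans _ R x z ->
  (forall w, ~ R y w) -> (forall w, ~ R z w) -> y = z.
Proof.
intros Hlc; induction 1 as [x Hx IH]; intros y z Hy Hz Ny Nz.
apply clos_rt_rt1n in Hy, Hz.
destruct Hy as [|y1 y Hy1 Hy]; destruct Hz as [|z1 z Hz1 Hz];
  auto; try (now exfalso; eapply Ny; eauto); try (now exfalso; eapply Nz; eauto).
apply clos_rt1n_rt in Hy, Hz.
destruct (Hlc _ _ _ Hy1 Hz1) as (w & Hw1 & Hw2).
destruct (@Acc_normal_form _ R w) as (n & Hn & Nn).
{ eapply Acc_clos_rt; [exact Hw1|]; auto. }
transitivity n.
- apply (IH y1); auto; eapply rt_trans; eauto.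
- symmetry; apply (IH z1); auto; eapply rt_trans; eauto.
Qed.

Lemma ctx_inv (F : Type) (root : forall V : Type, tm F V -> tm F V -> Prop) V (t u : tm F V) :
  ctx root t u ->
  root V t u \/
  match t with
  | Pi A B => (exists A', u = Pi A' B /\ ctx root A A') \/ (exists B', u = Pi A B' /\ ctx root B B')
  | App a b => (exists a', u = App a' b /\ ctx root a a') \/ (exists b', u = App a b' /\ ctx root b b')
  | Lam A b => (exists A', u = Lam A' b /\ ctx root A A') \/ (exists b', u = Lam A b' /\ ctx root b b')
  | _ => False
  end.
Proof. destruct 1; eauto 6. Qed.

Lemma ctx_subst (F : Type) (root : forall V : Type, tm F V -> tm F V -> Prop) :
  (forall V W (sigma : V -> tm F W) t u, root V t u -> root W (subst sigma t) (subst sigma u)) ->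
  forall V (t u : tm F V), ctx root t u ->
  forall W (sigma : V -> tm F W), ctx root (subst sigma t) (subst sigma u).
Proof. intros H; induction 1; intros W sigma; simpl; constructor; now auto. Qed.

Section Termination.
Context {S : system}.
Notation F := (fsym S).
Notation D := (@Dcal S).
Notation I := (@in_interp S).

(** Unlike [SN], this makes sense for any type of free variables, because bodies of binders have to
    terminate too. *)
Definition sn {V : Type} (t : tm F V) : Prop := Acc (fun v u => red u v) t.
Definition redst {V : Type} (t u : tm F V) : Prop := clos_refl_trans _ (@red S V) t u.

Lemma SN_sn (t : term F) : SN t <-> sn t.
Proof. apply no_infinite_chain_Acc. Qed.

Lemma red_pi1 V (A A' : tm F V) B : red A A' -> red (Pi A B) (Pi A' B).
Proof. intros [H|H]; [left|right]; now apply ctx_pi1. Qed.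
Lemma red_pi2 V (A : tm F V) B B' : red B B' -> red (Pi A B) (Pi A B').
Proof. intros [H|H]; [left|right]; now apply ctx_pi2. Qed.
Lemma red_app1 V (t t' u : tm F V) : red t t' -> red (App t u) (App t' u).
Proof. intros [H|H]; [left|right]; now apply ctx_app1. Qed.
Lemma red_app2 V (t u u' : tm F V) : red u u' -> red (App t u) (App t u').
Proof. intros [H|H]; [left|right]; now apply ctx_app2. Qed.
Lemma red_lam1 V (A A' : tm F V) b : red A A' -> red (Lam A b) (Lam A' b).
Proof. intros [H|H]; [left|right]; now apply ctx_lam1. Qed.
Lemma red_lam2 V (A : tm F V) b b' : red b b' -> red (Lam A b) (Lam A b').
Proof. intros [H|H]; [left|right]; now apply ctx_lam2. Qed.

Lemma red_inv V (t u : tm F V) : red t u ->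
  (exists A b a, t = App (Lam A b) a /\ u = inst b a) \/
  (exists rho (sigma : name -> tm F V), rules rho /\
     t = fapps (head rho) (map (subst sigma) (args rho)) /\ u = subst sigma (rhs rho)) \/
  match t with
  | Pi A B => (exists A', u = Pi A' B /\ red A A') \/ (exists B', u = Pi A B' /\ red B B')
  | App a b => (exists a', u = App a' b /\ red a a') \/ (exists b', u = App a b' /\ red b b')
  | Lam A b => (exists A', u = Lam A' b /\ red A A') \/ (exists b', u = Lam A b' /\ red b b')
  | _ => False
  end.
Proof.
intros [H|H]; apply ctx_inv in H as [H|H].
- destruct H; left; eauto.
- right; right; unfold red; destruct t; auto;
    destruct H as [[x [? ?]]|[x [? ?]]]; eauto 6.
- destruct H as [rho sigma H]; right; left; exists rho, sigma; split; auto; split; auto.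
  unfold lhs; now rewrite subst_fapps.
- right; right; unfold red; destruct t; auto;
    destruct H as [[x [? ?]]|[x [? ?]]]; eauto 6.
Qed.

Lemma fapps_not_pi (V : Type) (f : F) ts A (B : tm F (option V)) : fapps f ts <> Pi A B.
Proof. destruct ts as [|t ts _] using rev_ind; unfold fapps; rewrite ?apps_app; discriminate. Qed.

Lemma fapps_not_lam (V : Type) (f : F) ts A (B : tm F (option V)) : fapps f ts <> Lam A B.
Proof. destruct ts as [|t ts _] using rev_ind; unfold fapps; rewrite ?apps_app; discriminate. Qed.

Lemma fapps_not_srt (V : Type) (f : F) (ts : list (tm F V)) s : fapps f ts <> Srt s.
Proof. destruct ts as [|t ts _] using rev_ind; unfold fapps; rewrite ?apps_app; discriminate. Qed.

Lemma fapps_not_var (V : Type) (f : F) (ts : list (tm F V)) x : fapps f ts <> Var x.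
Proof. destruct ts as [|t ts _] using rev_ind; unfold fapps; rewrite ?apps_app; discriminate. Qed.

Lemma red_pi_inv V (A : tm F V) B u : red (Pi A B) u ->
  (exists A', u = Pi A' B /\ red A A') \/ (exists B', u = Pi A B' /\ red B B').
Proof.
intros H; apply red_inv in H as [(? & ? & ? & ? & ?)|[(rho & s & _ & H & _)|H]]; auto.
- discriminate.
- symmetry in H; now apply fapps_not_pi in H.
Qed.

Lemma red_lam_inv V (A : tm F V) B u : red (Lam A B) u ->
  (exists A', u = Lam A' B /\ red A A') \/ (exists B', u = Lam A B' /\ red B B').
Proof.
intros H; apply red_inv in H as [(? & ? & ? & ? & ?)|[(rho & s & _ & H & _)|H]]; auto.
- discriminate.
- symmetry in H; now apply fapps_not_lam in H.
Qed.

Lemma red_srt V s (u : tm F V) : ~ red (Srt s) u.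
Proof.
intros H; apply red_inv in H as [(? & ? & ? & ? & ?)|[(rho & s' & _ & H & _)|H]]; auto.
- discriminate.
- symmetry in H; now apply fapps_not_srt in H.
Qed.

Lemma red_var V x (u : tm F V) : ~ red (Var x) u.
Proof.
intros H; apply red_inv in H as [(? & ? & ? & ? & ?)|[(rho & s' & _ & H & _)|H]]; auto.
- discriminate.
- symmetry in H; now apply fapps_not_var in H.
Qed.

Lemma red_subst V W (sigma : V -> tm F W) t u : red t u -> red (subst sigma t) (subst sigma u).
Proof.
intros [H|H]; [left|right]; apply ctx_subst; auto; clear.
- intros V W sigma t u []; simpl; rewrite subst_inst, <- inst_up; constructor.
- intros V W sigma t u [rho tau H]; rewrite !subst_subst; constructor; auto.
Qed.

Lemma redst_subst V W (sigma : V -> tm F W) t u :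
  redst t u -> redst (subst sigma t) (subst sigma u).
Proof. apply clos_rt_map; intros; now apply red_subst. Qed.

Lemma sn_subst V W (sigma : V -> tm F W) t : sn (subst sigma t) -> sn t.
Proof. apply Acc_preimage with (T := @red S W); intros; now apply red_subst. Qed.

Lemma redst_pi V (A A' : tm F V) B B' : redst A A' -> redst B B' -> redst (Pi A B) (Pi A' B').
Proof.
intros HA HB; apply rt_trans with (Pi A' B).
- apply clos_rt_map with (h := fun A => Pi A B) (2 := HA); intros; now apply red_pi1.
- apply clos_rt_map with (h := fun B => Pi A' B) (2 := HB); intros; now apply red_pi2.
Qed.

Lemma redst_lam V (A A' : tm F V) B B' : redst A A' -> redst B B' -> redst (Lam A B) (Lam A' B').
Proof.
intros HA HB; apply rt_trans with (Lam A' B).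
- apply clos_rt_map with (h := fun A => Lam A B) (2 := HA); intros; now apply red_lam1.
- apply clos_rt_map with (h := fun B => Lam A' B) (2 := HB); intros; now apply red_lam2.
Qed.

Lemma redst_app V (t t' u u' : tm F V) : redst t t' -> redst u u' -> redst (App t u) (App t' u').
Proof.
intros HA HB; apply rt_trans with (App t' u).
- apply clos_rt_map with (h := fun t => App t u) (2 := HA); intros; now apply red_app1.
- apply clos_rt_map with (h := fun u => App t' u) (2 := HB); intros; now apply red_app2.
Qed.

Lemma subst_redst V W (sigma tau : V -> tm F W) t :
  (forall x, redst (sigma x) (tau x)) -> redst (subst sigma t) (subst tau t).
Proof.
revert W sigma tau; induction t; intros W sigma tau H; simpl; try apply rt_refl; auto.
- apply redst_pi; auto; apply IHt2; intros [x|]; simpl; [|apply rt_refl].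
  rewrite !ren_as_subst; now apply redst_subst.
- apply redst_app; auto.
- apply redst_lam; auto; apply IHt2; intros [x|]; simpl; [|apply rt_refl].
  rewrite !ren_as_subst; now apply redst_subst.
Qed.

Lemma inst_redst V (B B' : tm F (option V)) a a' :
  redst B B' -> redst a a' -> redst (inst B a) (inst B' a').
Proof.
intros HB Ha; apply rt_trans with (inst B' a).
- now apply redst_subst.
- apply subst_redst; intros [x|]; simpl; auto; apply rt_refl.
Qed.

Lemma redst_pi_inv V (A : tm F V) B u : redst (Pi A B) u ->
  exists A' B', u = Pi A' B' /\ redst A A' /\ redst B B'.
Proof.
intros H; apply clos_rt_rt1n in H; remember (Pi A B) as t eqn:E; revert A B E.
induction H as [|t t' u H _ IH]; intros A B ->.
- exists A, B; repeat split; apply rt_refl.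
- apply red_pi_inv in H as [(A' & -> & H)|(B' & -> & H)];
    destruct (IH _ _ eq_refl) as (A2 & B2 & -> & HA & HB);
    exists A2, B2; repeat split; auto; (eapply rt_trans; [apply rt_step|]; eauto).
Qed.

Lemma normal_redst V (t u : tm F V) : (forall v, ~ red t v) -> redst t u -> u = t.
Proof.
intros N H; apply clos_rt_rt1n in H; destruct H; auto; exfalso; eapply N; eauto.
Qed.

Lemma redst_srt V s (u : tm F V) : redst (Srt s) u -> u = Srt s.
Proof. apply normal_redst; intros v; apply red_srt. Qed.

Lemma redst_sn V (t u : tm F V) : redst t u -> sn t -> sn u.
Proof. apply Acc_clos_rt. Qed.

Lemma sn_srt V s : sn (Srt s : tm F V).
Proof. constructor; intros u Hu; now apply red_srt in Hu. Qed.

Lemma sn_pi V (A : tm F V) B : sn A -> sn B -> sn (Pi A B).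
Proof.
intros HA; revert B; induction HA as [A HA IHA]; intros B HB.
induction HB as [B HB IHB]; constructor; intros u Hu.
apply red_pi_inv in Hu as [(A' & -> & H)|(B' & -> & H)]; [|now apply IHB].
apply IHA; [exact H|constructor; exact HB].
Qed.

Lemma is_kind_red V (t u : tm F V) :
  is_kind t = true -> red t u -> is_kind u = true /\ ar u = ar t.
Proof.
revert u; induction t; intros u E H; simpl in E; try discriminate.
- now apply red_srt in H.
- apply red_pi_inv in H as [(A' & -> & H)|(B' & -> & H)]; simpl; auto.
  destruct (IHt2 _ E H); auto.
Qed.

Lemma is_kind_redst V (t u : tm F V) :
  is_kind t = true -> redst t u -> is_kind u = true /\ ar u = ar t.
Proof.
intros E H; induction H as [t u H| |t u v _ IH1 _ IH2]; auto.
- now apply is_kind_red.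
- destruct (IH1 E) as [E1 <-]; auto.
Qed.

Lemma joinable_subst (sigma : name -> term F) A B :
  joinable A B -> joinable (subst sigma A) (subst sigma B).
Proof. intros [C [H1 H2]]; exists (subst sigma C); split; now apply redst_subst. Qed.

(** * Reduction of argument lists and of applied symbols *)

Inductive reds1 {V : Type} : list (tm F V) -> list (tm F V) -> Prop :=
| reds1_head t t' ts : red t t' -> reds1 (t :: ts) (t' :: ts)
| reds1_tail t ts ts' : reds1 ts ts' -> reds1 (t :: ts) (t :: ts').

Lemma reds1_redst V (ts ts' : list (tm F V)) : reds1 ts ts' -> Forall2 redst ts ts'.
Proof.
induction 1; constructor; auto; try apply rt_refl.
- now apply rt_step.
- clear; induction ts; constructor; auto; apply rt_refl.
Qed.

Lemma reds1_snoc V (ts : list (tm F V)) t t' : red t t' -> reds1 (ts ++ [t]) (ts ++ [t']).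
Proof. intros H; induction ts; simpl; constructor; auto. Qed.

Lemma reds1_app V (ts ts' us : list (tm F V)) : reds1 ts ts' -> reds1 (ts ++ us) (ts' ++ us).
Proof. induction 1; simpl; constructor; auto. Qed.

Lemma reds1_Acc V (ts : list (tm F V)) : Forall sn ts -> Acc (fun v u => reds1 u v) ts.
Proof.
induction 1 as [|t ts Ht _ IH].
- constructor; intros v H; inversion H.
- revert ts IH; induction Ht as [t _ IHt]; intros ts IH.
  induction IH as [ts Hts IHts]; constructor; intros v H; inversion H; subst; auto.
  apply IHt; auto; constructor; auto.
Qed.

(** An applied symbol is no beta-redex, and a rule may consume only a prefix of the arguments,
    leaving [us]. *)
Lemma red_fapps V (f : F) ts (u : tm F V) : red (fapps f ts) u ->
  (exists ts', reds1 ts ts' /\ u = fapps f ts') \/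
  (exists rho (sigma : name -> tm F V) us, rules rho /\ head rho = f /\
     ts = map (subst sigma) (args rho) ++ us /\ u = apps (subst sigma (rhs rho)) us).
Proof.
revert u; induction ts as [|t ts IH] using rev_ind; intros u H.
- apply red_inv in H as [(? & ? & ? & ? & ?)|[(rho & s & Hr & E & ->)|[]]]; [discriminate|].
  right; exists rho, s, []; rewrite app_nil_r.
  change (fapps f [] = fapps (head rho) (map (subst s) (args rho))) in E.
  apply fapps_inj in E as [-> <-]; auto.
- unfold fapps in H |- *; rewrite apps_app in H; simpl in H.
  apply red_inv in H as [(A & b & a & E & _)|[(rho & s & Hr & E & ->)|[(v & -> & H)|(v & -> & H)]]].
  + injection E as E _; now apply fapps_not_lam in E.
  + right; exists rho, s, []; rewrite app_nil_r.
    apply app_fapps in E as (us & E1 & E2).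
    apply fapps_inj in E2 as [-> ->]; auto.
  + apply IH in H as [(ts' & H & ->)|(rho & s & us & Hr & Hh & -> & ->)].
    * left; exists (ts' ++ [t]); split; [now apply reds1_app|]; now rewrite apps_app.
    * right; exists rho, s, (us ++ [t]); rewrite app_assoc, apps_app; auto.
  + left; exists (ts ++ [v]); split; [now apply reds1_snoc|]; now rewrite apps_app.
Qed.

Hypothesis Hconfl : locally_confluent S.
Hypothesis Hpres : preserves_typing S.

(** * Interpretation of types *)

Lemma Fop_mono (G H : graph F) :
  (forall T P, G T P -> H T P) -> forall T P, Fop G T P -> Fop H T P.
Proof.
intros GH T P [[Hs Hd] HP]; split; [split; auto|].
- intros A B E; destruct (Hd A B E) as (PA & HA & HB).
  exists PA; split; auto; intros a Ha; destruct (HB a Ha) as (Q & HQ); eauto.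
- destruct HP as [(A & B & PA & Q & N & HA & HB & HP)|HP]; [left|right; auto].
  exists A, B, PA, Q; split; [|split; [|split]]; auto.
Qed.

Lemma interp_fold (T : term F) P : Fop (@interp S) T P -> interp T P.
Proof.
intros H G HG; apply HG; revert H; apply Fop_mono.
intros T' P' H; now apply H.
Qed.

(** Knaster and Tarski: [Fop] applied to [interp] is itself closed under [Fop], hence contains the
    intersection [interp]. *)
Lemma interp_unfold (T : term F) P : interp T P -> Fop (@interp S) T P.
Proof. intros H; apply H; clear; intros T P; apply Fop_mono; apply interp_fold. Qed.

Lemma interp_ext (T : term F) P P' :
  interp T P -> (forall t, P t <-> P' t) -> interp T P'.
Proof.
intros H E; apply interp_fold; apply interp_unfold in H as [Hd H]; split; auto.
destruct H as [(A & B & PA & Q & N & HA & HB & HP)|[N HP]]; [left|right].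
- exists A, B, PA, Q; repeat split; auto; try apply N; rewrite <- E; apply HP.
- split; auto; intros t; rewrite <- E; auto.
Qed.

Lemma normal_form_unique (T N N' : term F) :
  sn T -> normal_form_of T N -> normal_form_of T N' -> N = N'.
Proof.
intros HT [H1 H2] [H3 H4]; eapply newman; eauto.
Qed.

(** The normal form of a terminating type is unique, so both values come from the same product or
    both from the clause without product. Values are determined up to pointwise equivalence. *)
Lemma interp_fun (T : term F) P P' :
  interp T P -> interp T P' -> forall t, P t <-> P' t.
Proof.
intros H; revert P'.
(* Fixpoint induction: the intersection defining [interp] is instantiated with the claim,
   strengthened by [interp] itself so that components are known to be interpreted. *)
refine (proj2 (H (fun T P => interp T P /\ forall P', interp T P' -> forall t, P t <-> P' t) _)).
clear - Hconfl; intros T P HP.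
assert (HP' : interp T P) by (apply interp_fold; revert HP; apply Fop_mono; tauto).
split; auto; intros P' HP2.
destruct (interp_unfold HP') as [[Hs _] _]; apply SN_sn in Hs.
destruct HP as [_ HP]; apply interp_unfold in HP2 as [_ HP2].
destruct HP as [(A & B & PA & Q & N & HA & HB & HP)|[N HP]];
  destruct HP2 as [(A' & B' & PA' & Q' & N' & HA' & HB' & HP2)|[N' HP2]];
  try (exfalso; eauto 6; fail).
- assert (E := normal_form_unique Hs N N'); injection E as <- <-.
  destruct HA as [_ HA]; specialize (HA _ HA').
  intros t; rewrite HP, HP2; unfold Pi_set; split; intros Ht a Ha.
  + assert (Ha' : PA a) by now apply HA.
    destruct (HB a Ha') as [_ E]; apply (E (Q' a)); auto.
  + assert (Ha' : PA' a) by now apply HA.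
    destruct (HB a Ha) as [_ E]; apply (E (Q' a)); auto.
- intros t; rewrite HP, HP2; tauto.
Qed.

Lemma in_interp_iff (T : term F) P t : interp T P -> (I T t <-> P t).
Proof.
intros H; split.
- intros [P' [H1 H2]]; eapply interp_fun; eauto.
- intros Ht; exists P; auto.
Qed.

Lemma interp_I (T : term F) P : interp T P -> interp T (I T).
Proof.
intros H; apply interp_ext with P; auto; intros t; symmetry; now apply in_interp_iff.
Qed.

(** The normal form of [T] decides which clause of [Fop] applies, so a type in [Dcal] does have a
    value; [in_interp T] is its canonical representative. *)
Lemma D_interp (T : term F) : D T <-> interp T (I T).
Proof.
split; [|intros H; now apply interp_unfold in H as [H _]].
intros H; assert (Hs := proj1 H); apply SN_sn in Hs.
enough (exists P, interp T P) as [P HP] by now apply interp_I in HP.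
destruct (Acc_normal_form Hs) as (N & H1 & H2).
destruct (classic (exists A B, N = Pi A B)) as [(A & B & ->)|Hn].
- destruct (proj2 H A B H1) as (PA & HA & HB).
  exists (Pi_set PA (fun a => I (inst B a))); apply interp_fold; split; auto.
  left; exists A, B, PA, (fun a => I (inst B a)); repeat split; auto.
  intros a Ha; destruct (HB a Ha) as [Q HQ]; now apply interp_I in HQ.
- exists (@SN S); apply interp_fold; split; auto; right; split; [|tauto].
  intros (A & B & HAB); apply Hn; exists A, B.
  exact (normal_form_unique Hs (conj H1 H2) HAB).
Qed.

Lemma D_sn (T : term F) : D T -> sn T.
Proof. intros [H _]; now apply SN_sn. Qed.

Lemma D_redst (T T' : term F) : redst T T' -> D T -> D T'.
Proof.
intros E [H1 H2]; split.
- apply SN_sn in H1; apply SN_sn; eapply redst_sn; eauto.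
- intros A B H; apply H2; eapply rt_trans; eauto.
Qed.

Lemma D_reds_pi (T A : term F) B : D T -> redst T (Pi A B) ->
  D A /\ forall a, I A a -> D (inst B a).
Proof.
intros [_ H] E; destruct (H A B E) as (P & HA & HB); split.
- apply D_interp; now apply interp_I in HA.
- intros a Ha; apply (in_interp_iff a HA) in Ha; destruct (HB a Ha) as [Q HQ].
  apply D_interp; now apply interp_I in HQ.
Qed.

Lemma D_pi_inv (A : term F) B : D (Pi A B) -> D A /\ forall a, I A a -> D (inst B a).
Proof. intros H; apply (D_reds_pi H); apply rt_refl. Qed.

(** A terminating type and its reducts share their normal form, and the value depends only on
    that. *)
Lemma interp_redst (T T' : term F) P : redst T T' -> interp T P -> interp T' P.
Proof.
intros E H; assert (HD : D T) by now apply interp_unfold in H as [H _].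
assert (Hs := D_sn HD); apply interp_unfold in H as [_ H]; apply interp_fold; split.
{ now apply (D_redst E). }
assert (HN : forall N, normal_form_of T N <-> normal_form_of T' N).
{ intros N; split; intros [H1 H2]; split; auto.
  - destruct (Acc_normal_form (redst_sn E Hs)) as (N' & H1' & H2').
    assert (E' : normal_form_of T N') by exact (conj (rt_trans _ _ _ _ _ E H1') H2').
    rewrite (normal_form_unique Hs (conj H1 H2) E'); exact H1'.
  - eapply rt_trans; eauto. }
destruct H as [(A & B & PA & Q & N & HA & HB & HP)|[N HP]]; [left|right].
- exists A, B, PA, Q; split; [now apply HN|auto].
- split; auto; intros (A & B & HAB); apply N; exists A, B; now apply HN.
Qed.

Lemma I_redst (T T' : term F) t : redst T T' -> D T -> (I T t <-> I T' t).
Proof.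
intros E H; apply D_interp in H; symmetry; apply in_interp_iff.
now apply (interp_redst E).
Qed.

Lemma D_pi (A : term F) B :
  sn (Pi A B) -> D A -> (forall a, I A a -> D (inst B a)) -> D (Pi A B).
Proof.
intros Hs HA HB; split; [now apply SN_sn|].
intros A' B' E; apply redst_pi_inv in E as (A2 & B2 & E & EA & EB).
injection E as -> ->; exists (I A2); split.
- now apply D_interp, (D_redst EA).
- intros a Ha; exists (I (inst B2 a)); apply D_interp.
  apply (D_redst (T := inst B a)); [now apply redst_subst|].
  apply HB; now apply (I_redst a EA).
Qed.

Lemma I_pi (A : term F) B t : D (Pi A B) ->
  (I (Pi A B) t <-> forall a, I A a -> I (inst B a) (App t a)).
Proof.
intros H; destruct (D_pi_inv H) as [HA HB].
destruct (Acc_normal_form (D_sn H)) as (N & H1 & H2).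
destruct (redst_pi_inv H1) as (A' & B' & -> & EA & EB).
assert (H' := proj1 (D_interp _) H); apply interp_unfold in H' as [_ H'].
destruct H' as [(A2 & B2 & PA & Q & N & HA' & HB' & HP)|[N _]].
- assert (E := normal_form_unique (D_sn H) (conj H1 H2) N); injection E as <- <-.
  rewrite HP; unfold Pi_set.
  assert (EPA : forall a, PA a <-> I A a).
  { intros a; rewrite (I_redst a EA HA); symmetry; now apply in_interp_iff. }
  assert (EQ : forall a, PA a -> I (inst B a) (App t a) <-> Q a (App t a)).
  { intros a Ha; rewrite (I_redst (T' := inst B' a)).
    - now apply in_interp_iff, HB'.
    - now apply redst_subst.
    - now apply HB, EPA. }
  split; intros Ht a Ha; apply EPA in Ha as Ha'; apply EQ; auto.
- exfalso; apply N; exists A', B'; split; auto.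
Qed.

Lemma I_not_pi (T : term F) t : D T -> (forall A B, ~ redst T (Pi A B)) -> (I T t <-> sn t).
Proof.
intros H N; apply D_interp in H; apply interp_unfold in H as [_ H].
destruct H as [(A & B & PA & Q & [N' _] & _)|[_ HP]]; [now apply N in N'|].
rewrite HP; apply SN_sn.
Qed.

Lemma D_srt s : D (Srt s).
Proof.
split; [apply SN_sn, sn_srt|]; intros A B H; apply redst_srt in H; discriminate.
Qed.

(** Here [interp] and [sem] part: the latter interprets a sort by [Dcal], a smaller set by
    [D_sn]. *)
Lemma I_srt s t : I (Srt s) t <-> sn t.
Proof.
apply I_not_pi; [apply D_srt|]; intros A B H; apply redst_srt in H; discriminate.
Qed.

(** Induction along the construction of the least fixpoint: the components of a product reduct enter
    [interp] before the type does. Structural induction would not do, since [inst B a] may be larger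
    than the type. *)
Lemma D_ind (Pr : term F -> Prop) :
  (forall T, D T -> (forall A B, redst T (Pi A B) ->
     Pr A /\ forall a, I A a -> Pr (inst B a)) -> Pr T) ->
  forall T, D T -> Pr T.
Proof.
intros IH T HT; apply D_interp in HT.
refine (proj2 (HT (fun T P => interp T P /\ Pr T) _)).
clear T HT; intros T P [HD HP].
assert (H' : interp T P).
{ apply interp_fold, (@Fop_mono (fun T P => interp T P /\ Pr T)); [tauto|split; auto]. }
split; auto; apply IH; [now apply interp_unfold in H' as [H' _]|].
intros A B E; destruct HD as [_ HD]; destruct (HD A B E) as (PA & [HA HA'] & HB).
split; auto; intros a Ha.
apply (in_interp_iff a HA) in Ha; now destruct (HB a Ha) as (Q & _ & HQ).
Qed.

(** ** Reducibility candidates *)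

(** Putting a neutral term in a context [App _ a] creates no root redex. *)
Definition neutral (t : term F) : Prop :=
  (forall A b, t <> Lam A b) /\ (forall A B, t <> Pi A B) /\
  forall rho us, rules rho -> t = fapps (head rho) us -> length (args rho) <= length us.

(** Girard's conditions CR1, CR2 and CR3. *)
Definition cand (P : term F -> Prop) : Prop :=
  (forall t, P t -> sn t) /\ (forall t u, P t -> red t u -> P u) /\
  (forall t, neutral t -> (forall u, red t u -> P u) -> P t).

Lemma cand_redst P t u : cand P -> P t -> redst t u -> P u.
Proof. intros [_ [H _]] Ht E; revert Ht; induction E; eauto. Qed.

Lemma cand_var P x : cand P -> P (Var x).
Proof.
intros (_ & _ & H); apply H.
- repeat split; try discriminate.
  intros rho us _ E; symmetry in E; now apply fapps_not_var in E.
- intros u Hu; now apply red_var in Hu.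
Qed.

Lemma cand_ext (P P' : term F -> Prop) : (forall t, P t <-> P' t) -> cand P -> cand P'.
Proof.
intros E (H1 & H2 & H3); split; [|split].
- intros t; rewrite <- E; auto.
- intros t u; rewrite <- !E; eauto.
- intros t Hn H; apply E, H3; auto; intros u Hu; apply E; auto.
Qed.

Lemma cand_sn : cand (@sn name).
Proof.
split; [|split]; auto.
- intros t u [H] E; now apply H.
- intros t _ H; constructor; auto.
Qed.

(** Neutral terms are not products, so a neutral type reaches a product after at least one step, and
    membership of that first reduct provides the components. *)
Lemma cand_D : cand D.
Proof.
split; [|split].
- apply D_sn.
- intros t u H E; apply (D_redst (T := t)); auto; now apply rt_step.
- intros t H H0; split.
  + apply SN_sn; constructor; intros u Hu; now apply D_sn, H0.
  + intros A B E; apply clos_rt_rt1n in E; remember (Pi A B) as T eqn:ET.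
    destruct E as [|u T E E']; subst; [now destruct H as (_ & H & _); elim (H A B)|].
    apply clos_rt1n_rt in E'; destruct (H0 _ E) as [_ H']; now apply H'.
Qed.

Lemma neutral_app (t a : term F) : neutral t -> neutral (App t a).
Proof.
intros (_ & _ & H); repeat split; try discriminate.
intros rho us Hr E; apply app_fapps in E as (vs & -> & E).
rewrite length_app; specialize (H rho vs Hr E); simpl; lia.
Qed.

Lemma red_neutral_app (t a u : term F) : neutral t -> red (App t a) u ->
  (exists t', u = App t' a /\ red t t') \/ (exists a', u = App t a' /\ red a a').
Proof.
intros (H1 & _ & H) E; apply red_inv in E as [(A & b & c & E & _)|[(rho & s & Hr & E & _)|E]]; auto.
- injection E as -> _; now elim (H1 A b).
- apply app_fapps in E as (vs & E1 & E2); apply (H rho) in E2; auto.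
  apply (f_equal (@length _)) in E1.
  rewrite length_map, length_app in E1; simpl in E1; unfold term in *; lia.
Qed.

(** The variable in [P] yields termination from a single application. The last hypothesis serves the
    neutral case: a reduction of the argument moves [App t a] to [Q a'], and the result has to come
    back to [Q a]. *)
Lemma cand_pi (P : term F -> Prop) (Q : term F -> term F -> Prop) :
  cand P -> (forall a, P a -> cand (Q a)) ->
  (forall a a' t, P a -> red a a' -> Q a' t -> Q a t) ->
  cand (Pi_set P Q).
Proof.
intros HP HQ HE; unfold Pi_set; split; [|split].
- intros t Ht; assert (Hx := cand_var 0 HP).
  assert (Hs : sn (App t (Var 0))) by now apply (HQ _ Hx), Ht.
  apply (Acc_preimage (T := @red S name) (h := fun t => App t (Var 0))); auto.
  intros; now apply red_app1.
- intros t u Ht E a Ha; apply (proj1 (proj2 (HQ a Ha)) (App t a)); auto; now apply red_app1.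
- intros t Hn Ht a Ha.
  assert (Hs : sn a) by now apply HP.
  induction Hs as [a _ IH].
  apply (proj2 (proj2 (HQ a Ha))); [now apply neutral_app|].
  intros u Hu; apply red_neutral_app in Hu as [(t' & -> & E)|(a' & -> & E)]; auto.
  apply HE with a'; auto; apply IH; auto; now apply (proj1 (proj2 HP) a).
Qed.

Lemma cand_I (T : term F) : D T -> cand (I T).
Proof.
revert T; apply D_ind; intros T HT IH.
destruct (classic (exists A B, redst T (Pi A B))) as [(A & B & E)|Hn].
- destruct (IH A B E) as [HA HB]; destruct (D_reds_pi HT E) as [HA' HB'].
  apply cand_ext with (Pi_set (I A) (fun a => I (inst B a))).
  { intros t; rewrite (I_redst t E HT), I_pi; [reflexivity|]; now apply (D_redst E). }
  apply cand_pi; auto.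
  intros a a' t Ha Ea; apply I_redst; auto.
  apply inst_redst; [apply rt_refl|now apply rt_step].
- apply cand_ext with (@sn name); [|apply cand_sn].
  intros t; rewrite I_not_pi; auto; [reflexivity|]; intros A B E; eauto.
Qed.

(** ** Types seen through their first products *)

(** Up to typing conditions, [sem T sigma] depends only on [subst sigma T], the
    number [n] of products of [T], and whether these products form a kind, [b].
    This makes [sem] compatible with substitution without an induction on types. *)
Fixpoint arity_sem (b : bool) (n : nat) (T h : term F) : Prop :=
  match n with
  | 0 => if b then D h else I T h
  | Datatypes.S n => forall A B, T = Pi A B -> forall a, I A a -> arity_sem b n (inst B a) (App h a)
  end.

Lemma le_ar_inst n (A : term F) B a : Datatypes.S n <= ar (Pi A B) -> n <= ar (inst B a).
Proof. simpl; intros H; enough (ar B <= ar (inst B a)) by lia; apply ar_subst. Qed.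

(** The bound [n <= ar T] guarantees that the type shows a product at each unfolding; otherwise
    [arity_sem] would hold vacuously. *)
Lemma arity_sem_redst b n (T T' : term F) h :
  n <= ar T -> D T -> redst T T' -> (arity_sem b n T h <-> arity_sem b n T' h).
Proof.
revert T T' h; induction n as [|n IH]; intros T T' h Hn HD E.
- destruct b; simpl; [tauto|]; now apply I_redst.
- destruct T as [| | |A B| |]; try (simpl in Hn; lia).
  destruct (redst_pi_inv E) as (A' & B' & -> & EA & EB); destruct (D_pi_inv HD) as [HA HB].
  assert (EX : forall a, I A a -> arity_sem b n (inst B a) (App h a) <-> arity_sem b n (inst B' a) (App h a)).
  { intros a Ha; apply IH; auto; [now apply le_ar_inst with A|now apply redst_subst]. }
  simpl; split; intros H ? ? Eq a Ha; injection Eq as <- <-.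
  + apply (I_redst a EA HA) in Ha; apply EX; eauto.
  + apply EX; auto; apply (I_redst a EA HA) in Ha; eauto.
Qed.

(** Outside kinds, how many products are unfolded is immaterial, by [I_pi]. An instance with more
    products than the original type is therefore harmless. *)
Lemma arity_sem_false n (T : term F) h : n <= ar T -> D T -> (arity_sem false n T h <-> I T h).
Proof.
revert T h; induction n as [|n IH]; intros T h Hn HD; [reflexivity|].
destruct T as [| | |A B| |]; try (simpl in Hn; lia).
destruct (D_pi_inv HD) as [HA HB]; rewrite (I_pi h HD); simpl; split.
- intros H a Ha; apply IH; eauto; now apply le_ar_inst with A.
- intros H ? ? Eq a Ha; injection Eq as <- <-; apply IH; auto; now apply le_ar_inst with A.
Qed.

Lemma cand_arity_sem b n (T : term F) : n <= ar T -> D T -> cand (arity_sem b n T).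
Proof.
revert T; induction n as [|n IH]; intros T Hn HD.
- destruct b; simpl; [apply cand_D|now apply cand_I].
- destruct T as [| | |A B| |]; try (simpl in Hn; lia).
  destruct (D_pi_inv HD) as [HA HB].
  apply cand_ext with (Pi_set (I A) (fun a => arity_sem b n (inst B a))).
  { intros t; unfold Pi_set; simpl; split; eauto.
    intros H ? ? Eq; injection Eq as <- <-; auto. }
  apply cand_pi.
  + now apply cand_I.
  + intros a Ha; apply IH; auto; now apply le_ar_inst with A.
  + intros a a' t Ha E; apply arity_sem_redst; auto.
    * now apply le_ar_inst with A.
    * apply inst_redst; [apply rt_refl|now apply rt_step].
Qed.

(** Both readings unfold the same products and differ at the final sort only, where [Dcal] is
    included in the terminating terms. This handles a type that an untyped substitution has turned
    into a kind. *)
Lemma arity_sem_true_false (V : Type) (T : tm F V) (sigma : V -> term F) h :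
  kd T = true -> D (subst sigma T) ->
  arity_sem true (ar T) (subst sigma T) h -> I (subst sigma T) h.
Proof.
revert sigma h; induction T; intros sigma h HT HD; simpl in HT |- *; try discriminate.
- intros H; apply I_srt; now apply D_sn.
- intros H; simpl in HD; destruct (D_pi_inv HD) as [HA HB].
  apply I_pi; auto; intros a Ha; specialize (H _ _ eq_refl a Ha).
  specialize (HB a Ha); rewrite inst_up in *; apply IHT2; auto; now apply is_kind_kd.
Qed.

(** On a kind, [sem] recurs on the domains whereas [arity_sem] takes them in [interp]. By [wk] the
    domains are neither kinds nor [KIND], where the two agree. *)
Lemma sem_arity_sem (V : Type) (T : tm F V) (sigma : V -> term F) h :
  wk T -> D (subst sigma T) ->
  (sem T sigma h <-> arity_sem (kd T) (ar T) (subst sigma T) h).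
Proof.
assert (Hst : forall T h, D T -> sem_type T h <-> I T h).
{ intros T0 h0 H; unfold sem_type; tauto. }
revert sigma h; induction T; intros sigma h HT HD; simpl sem; simpl kd;
  try (simpl ar; now apply Hst).
- simpl; reflexivity.
- simpl in HT; destruct (is_kind T2) eqn:EK.
  + destruct (HT eq_refl) as [E HT2]; simpl in HD; destruct (D_pi_inv HD) as [HA HB].
    assert (HwA : wk T1).
    { destruct T1; simpl; auto; simpl in E; rewrite E; discriminate. }
    assert (EA : forall a, sem T1 sigma a <-> I (subst sigma T1) a).
    { intros a; rewrite IHT1, E; auto; apply arity_sem_false; auto; apply ar_subst. }
    simpl; unfold Pi_set; split.
    * intros H ? ? Eq a Ha; injection Eq as <- <-.
      specialize (HB a Ha); rewrite inst_up in *.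
      specialize (H a (proj2 (EA a) Ha)); apply IHT2 in H; auto.
      now rewrite (is_kind_kd EK) in H.
    * intros H a Ha; apply EA in Ha; specialize (H _ _ eq_refl a Ha).
      specialize (HB a Ha); rewrite inst_up in *.
      apply IHT2; auto; now rewrite (is_kind_kd EK).
  + rewrite arity_sem_false; auto; apply (ar_subst sigma (Pi T1 T2)).
Qed.

(** ** Lists of arguments of a product *)

(** Counterpart of [models] without names, for the arguments of a product; [rest] is the type left
    once they are supplied. *)
Fixpoint tele (T : term F) (ts : list (term F)) : Prop :=
  match ts, T with
  | [], _ => True
  | t :: ts, Pi A B => I A t /\ tele (inst B t) ts
  | _, _ => False
  end.

Fixpoint rest (T : term F) (ts : list (term F)) : term F :=
  match ts, T with
  | t :: ts, Pi A B => rest (inst B t) ts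
  | _, _ => T
  end.

Lemma tele_D (T : term F) ts : D T -> tele T ts -> D (rest T ts).
Proof.
revert T; induction ts as [|t ts IH]; intros T HD H; simpl in *; auto.
destruct T as [| | |A B| |]; auto; destruct H; apply IH; auto; now apply (D_pi_inv HD).
Qed.

Lemma rest_app (T : term F) us vs : rest T (us ++ vs) = rest (rest T us) vs.
Proof.
revert T; induction us as [|u us IH]; intros T; simpl; auto.
destruct T; auto; destruct vs; reflexivity.
Qed.

Lemma tele_app (T : term F) us vs : tele T (us ++ vs) <-> tele T us /\ tele (rest T us) vs.
Proof.
revert T; induction us as [|u us IH]; intros T; simpl; [tauto|].
destruct T; try tauto; rewrite IH; tauto.
Qed.

Lemma tele_sn (T : term F) ts : D T -> tele T ts -> Forall sn ts.
Proof.
revert T; induction ts as [|t ts IH]; intros T HD H; simpl in *; constructor;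
  destruct T as [| | |A B| |]; try tauto; destruct H as [H1 H2];
  destruct (D_pi_inv HD) as [HA HB].
- now apply (cand_I HA).
- now apply (IH (inst B t)); auto.
Qed.

Lemma tele_redst (T T' : term F) ts ts' :
  D T -> redst T T' -> Forall2 redst ts ts' -> tele T ts ->
  tele T' ts' /\ redst (rest T ts) (rest T' ts').
Proof.
intros HD E H; revert T T' HD E; induction H as [|t t' ts ts' Ht _ IH];
  intros T T' HD E HT; [simpl; auto|].
destruct T as [| | |A B| |]; try (now elim HT); destruct HT as [H1 H2].
destruct (redst_pi_inv E) as (A' & B' & -> & EA & EB); destruct (D_pi_inv HD) as [HA HB].
destruct (IH (inst B t) (inst B' t')) as [H3 H4]; auto.
{ now apply inst_redst. }
simpl; repeat split; auto.
apply (I_redst t' EA HA); apply cand_redst with t; auto; now apply cand_I.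
Qed.

Lemma arity_sem_apps b n (T : term F) h : n <= ar T ->
  (arity_sem b n T h <-> forall ts, length ts = n -> tele T ts -> arity_sem b 0 (rest T ts) (apps h ts)).
Proof.
revert T h; induction n as [|n IH]; intros T h Hn.
- split.
  + intros H [|t ts] E _; [exact H|discriminate].
  + intros H; exact (H [] eq_refl Logic.I).
- destruct T as [| | |A B| |]; try (simpl in Hn; lia); split.
  + intros H [|t ts] E Ht; [discriminate|]; injection E as E; destruct Ht as [H1 H2].
    exact (proj1 (IH _ _ (le_ar_inst t Hn)) (H A B eq_refl t H1) ts E H2).
  + intros H ? ? Eq a Ha; injection Eq as <- <-.
    apply IH; [now apply le_ar_inst with A|]; intros ts El Ht.
    apply (H (a :: ts)); simpl; auto.
Qed.

Lemma rest_pis (G : env F) V (sigma : name -> term F) :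
  rest (subst sigma (pis G V)) (map sigma (dom G)) = subst sigma V.
Proof.
induction G as [|[x A] G IH]; simpl; auto; now rewrite inst_pis.
Qed.

(** As no declared type is a kind or [KIND], the [sem] of [models] and the [interp] of [tele]
    coincide on them. This links [Cset] and accessibility, stated with names, to [tele]. *)
Lemma tele_pis (G : env F) V (sigma : name -> term F) :
  D (subst sigma (pis G V)) -> (forall y U, In (y, U) G -> kd U = false) ->
  (tele (subst sigma (pis G V)) (map sigma (dom G)) <-> models sigma G).
Proof.
unfold models; induction G as [|[x A] G IH]; intros HD HG; simpl; [tauto|].
simpl in HD; destruct (D_pi_inv HD) as [HA HB].
assert (HB' : I (subst sigma A) (sigma x) -> D (subst sigma (pis G V))).
{ rewrite <- (inst_pis G x V); auto. }
assert (EA : sem A sigma (sigma x) <-> I (subst sigma A) (sigma x)).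
{ assert (E := HG x A (or_introl eq_refl)); rewrite sem_arity_sem, E; auto.
  - apply arity_sem_false; auto; apply ar_subst.
  - destruct A; simpl; auto; simpl in E; rewrite E; discriminate. }
rewrite inst_pis; split.
- intros [H1 H2] y U [E|Hy]; [injection E as <- <-; now apply EA|].
  apply IH; auto; intros; eapply HG; simpl; eauto.
- intros H; assert (Hx := proj1 EA (H x A (or_introl eq_refl))); split; auto.
  apply IH; auto; intros; eapply HG; simpl; eauto.
Qed.

(** * Typing *)

Lemma typing_mono (ok ok' : F -> Prop) Gamma t T :
  (forall f, ok f -> ok' f) -> typing ok Gamma t T -> typing ok' Gamma t T.
Proof. intros H; induction 1; econstructor; now eauto. Qed.

Lemma typing_typed (ok : F -> Prop) Gamma t T : typing ok Gamma t T -> typed Gamma t T.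
Proof. apply typing_mono; auto. Qed.

Inductive wf : env F -> Prop :=
| wf_nil : wf []
| wf_cons Gamma x A s :
    wf Gamma -> typed Gamma A (Srt s) -> ~ In x (dom Gamma) -> wf ((x, A) :: Gamma).

Lemma typed_wf (Gamma : env F) t T : typed Gamma t T -> wf Gamma.
Proof. induction 1; auto; econstructor; eauto. Qed.

Lemma typed_free_both (Gamma : env F) t T x :
  typed Gamma t T -> free x t \/ free x T -> In x (dom Gamma).
Proof.
intros H; revert x; induction H; intros z; simpl in *.
- tauto.
- intros [->|Hz]; auto.
- intros Hz; right; auto.
- intros [[Hz|Hz]|[]]; auto.
  apply free_close in Hz as [n Hz]; destruct (IHtyping2 z); auto; congruence.
- intros [[Hz|Hz]|Hz]; auto.
  apply free_close in Hz as [n Hz]; destruct (IHtyping1 z); auto; congruence.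
- intros [[Hz|Hz]|Hz]; auto.
  apply free_subst in Hz as [[y|] [H1 H2]]; simpl in H2; subst; auto.
- intros [Hz|Hz]; auto.
- intros [[]|Hz]; exact (IHtyping z (or_introl Hz)).
Qed.

Lemma typed_free (Gamma : env F) t T x : typed Gamma t T -> free x t -> In x (dom Gamma).
Proof. intros H Hx; apply (typed_free_both (x := x)) in H; auto. Qed.

Lemma subst_typed_nil t T (sigma : name -> term F) : typed [] t T -> subst sigma t = t.
Proof. intros H; apply subst_id; intros x Hx; now apply (typed_free H) in Hx. Qed.

Lemma typed_weak_nil (Gamma : env F) t T : wf Gamma -> typed [] t T -> typed Gamma t T.
Proof. intros H Ht; induction H; auto; eapply ty_weak; eauto. Qed.

Lemma wf_in (Gamma : env F) x A : wf Gamma -> In (x, A) Gamma -> exists s, typed Gamma A (Srt s).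
Proof.
induction 1 as [|Gamma y B s Hw IH HB Hy]; simpl; [tauto|].
intros [E|H].
- injection E as -> ->; exists s; eapply ty_weak; eauto.
- destruct (IH H) as [s' Hs]; exists s'; eapply ty_weak; eauto.
Qed.

Lemma in_dom (Gamma : env F) x A : In (x, A) Gamma -> In x (dom Gamma).
Proof. apply (in_map fst). Qed.

Lemma dom_in (Gamma : env F) x : In x (dom Gamma) -> exists A, In (x, A) Gamma.
Proof. intros H; apply in_map_iff in H as [[y A] [<- H]]; eauto. Qed.

(** ** Kinds *)

Lemma typed_kindless (Gamma : env F) t T :
  typed Gamma t T -> kindless t /\ (T = Srt KIND \/ kindless T).
Proof.
assert (KS : forall s : sort, Srt s = Srt KIND :> term F \/ kindless (Srt s : term F)).
{ intros []; simpl; auto. }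
induction 1; simpl in *; try tauto.
- destruct IHtyping1, IHtyping2; repeat split; auto; now apply kindless_ren.
- destruct IHtyping1, IHtyping2 as [[? ?] ?]; repeat split; auto; now apply kindless_ren.
- destruct IHtyping1 as [? [E|[? ?]]], IHtyping2; [discriminate|].
  repeat split; auto; right; now apply kindless_inst.
Qed.

Lemma KIND_not_typed (Gamma : env F) T : ~ typed Gamma (Srt KIND) T.
Proof. intros H; now apply typed_kindless in H as [H _]. Qed.

Lemma typed_reds (Gamma : env F) t u T : typed Gamma t T -> reds t u -> typed Gamma u T.
Proof. intros H E; revert H; induction E; eauto. Qed.

(** [KIND] is normal, so [B] would reduce to it, and preservation of typing would make [KIND]
    typable. *)
Lemma KIND_not_joinable (Gamma : env F) B T : joinable (Srt KIND) B -> ~ typed Gamma B T.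
Proof.
intros [C [H1 H2]] H; apply redst_srt in H1 as ->.
eapply KIND_not_typed, typed_reds; eauto.
Qed.

Lemma is_kind_typed (Gamma : env F) t T : typed Gamma t T -> is_kind t = true -> T = Srt KIND.
Proof.
induction 1; simpl; try discriminate; auto.
- intros E; rewrite is_kind_close in E; auto.
- intros E; rewrite (IHtyping1 E) in H0; now apply (KIND_not_joinable H0) in H1.
Qed.

(** With the previous lemma, the typable kinds are exactly the terms of type [KIND]: conversion can
    neither leave [KIND] nor reach it. *)
Lemma typed_KIND (Gamma : env F) t T : typed Gamma t T -> T = Srt KIND -> is_kind t = true.
Proof.
induction 1; intros E; auto; subst; simpl; try discriminate.
- now apply KIND_not_typed in H.
- rewrite is_kind_close; auto.
- apply typed_kindless in H as [_ [H|[_ H]]]; [discriminate|].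
  apply typed_kindless in H0 as [H0 _].
  assert (HK := kindless_inst H H0); now rewrite E in HK.
- now apply KIND_not_typed in H1.
- now rewrite E in H; apply KIND_not_typed in H.
Qed.

Lemma typed_kd (Gamma : env F) t T : typed Gamma t T -> kd t = is_kind t.
Proof. intros H; apply kindless_kd; now apply typed_kindless in H. Qed.

Lemma typed_TYPE_kd (Gamma : env F) t : typed Gamma t (Srt TYPE) -> kd t = false.
Proof.
intros H; rewrite (typed_kd H); destruct (is_kind t) eqn:E; auto.
now apply (is_kind_typed H) in E.
Qed.

Lemma typed_wk (Gamma : env F) t T : typed Gamma t T -> wk t.
Proof.
induction 1; simpl; auto.
intros _; split; [now apply typed_TYPE_kd in H|now apply wk_ren].
Qed.

(** ** Substitution *)

Definition wtsub (gamma : name -> term F) (Gamma Gamma' : env F) : Prop :=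
  forall x A, In (x, A) Gamma -> typed Gamma' (gamma x) (subst gamma A).

Lemma subst_Var (V : Type) (t : tm F V) : subst Var t = t.
Proof. now apply subst_id. Qed.

Lemma wtsub_id (Gamma : env F) : wf Gamma -> wtsub Var Gamma Gamma.
Proof.
induction 1 as [|Gamma x A s Hw IH HA Hx]; intros y B; simpl; [tauto|].
intros [E|H].
- injection E as <- <-; rewrite subst_Var; now apply ty_var with s.
- eapply ty_weak; eauto; now apply IH.
Qed.

Lemma wtsub_weak gamma (Gamma Gamma' : env F) x A s :
  typed Gamma' A (Srt s) -> ~ In x (dom Gamma') ->
  wtsub gamma Gamma Gamma' -> wtsub gamma Gamma ((x, A) :: Gamma').
Proof. intros HA Hx H y B Hy; eapply ty_weak; eauto; now apply H. Qed.

Lemma subst_upd_fresh (gamma : name -> term F) x a t :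
  ~ free x t -> subst (upd gamma x a) t = subst gamma t.
Proof.
intros H; apply subst_ext_free; intros y Hy; apply upd_other; congruence.
Qed.

Lemma wf_cons_inv x A (Gamma : env F) : wf ((x, A) :: Gamma) ->
  wf Gamma /\ ~ In x (dom Gamma) /\ ~ free x A /\
  forall y B, In (y, B) Gamma -> y <> x /\ ~ free x B.
Proof.
intros H; inversion H as [|G y B s HG HA Hx]; subst; repeat split; auto.
- intros Hf; now apply (typed_free HA) in Hf.
- intros ->; apply Hx; eapply in_dom; eauto.
- intros Hf; destruct (wf_in HG H0) as [s' Hs]; now apply (typed_free Hs) in Hf.
Qed.

Lemma wtsub_upd gamma (Gamma Gamma' : env F) x A a :
  wf ((x, A) :: Gamma) -> wtsub gamma Gamma Gamma' -> typed Gamma' a (subst gamma A) ->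
  wtsub (upd gamma x a) ((x, A) :: Gamma) Gamma'.
Proof.
intros Hw H Ha y B; destruct (wf_cons_inv Hw) as (_ & _ & HA & HG).
intros [E|Hy].
- injection E as <- <-; now rewrite upd_same, subst_upd_fresh.
- destruct (HG y B Hy); rewrite upd_other, subst_upd_fresh; auto.
Qed.

Lemma fresh_name (l : list name) : exists y, ~ In y l.
Proof.
destruct (list_bounded l) as [N HN]; exists N; intros H; apply HN in H; lia.
Qed.

Lemma typed_pi_dom (Gamma : env F) A B T : typed Gamma (Pi A B) T -> typed Gamma A (Srt TYPE).
Proof.
intros H; remember (Pi A B) as t eqn:E; revert A B E.
induction H; intros A0 B0 E; try discriminate; eauto.
- eapply ty_weak; eauto; exact (IHtyping2 _ _ E).
- now injection E as <- _.
Qed.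

Lemma typed_subst (Gamma : env F) t T : typed Gamma t T ->
  forall Gamma' gamma, wf Gamma' -> wtsub gamma Gamma Gamma' ->
  typed Gamma' (subst gamma t) (subst gamma T).
Proof.
assert (Fr : forall gamma (Gamma Gamma' : env F) y t T,
  wtsub gamma Gamma Gamma' -> ~ In y (dom Gamma') ->
  typed Gamma t T -> forall z, free z t -> ~ free y (gamma z)).
{ intros gamma G G' y u U Hg Hy Hu z Hz Hf; apply Hy.
  destruct (dom_in (typed_free Hu Hz)) as [C HC]; exact (typed_free (Hg z C HC) Hf). }
induction 1; intros Gamma' gamma Hw Hg.
- apply typed_weak_nil; auto; apply ty_sort.
- apply Hg; simpl; auto.
- apply IHtyping2; auto; intros y C Hy; apply Hg; simpl; auto.
(* [x] may already be declared in [Gamma'], so the binder is renamed to a fresh [y]. *)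
- destruct (fresh_name (dom Gamma')) as [y Hy].
  assert (HA := IHtyping1 _ _ Hw Hg).
  rewrite (subst_pi (y := y)).
  2: { eapply Fr; eauto; eapply ty_prod; eauto. }
  simpl; apply ty_prod; auto; apply (IHtyping2 _ (upd gamma x (Var y))).
  + econstructor; eauto.
  + apply wtsub_upd; [now apply typed_wf in H0| |].
    * now apply (wtsub_weak HA).
    * now apply ty_var with (1 := HA).
- destruct (fresh_name (dom Gamma')) as [y Hy].
  assert (HP := IHtyping2 _ _ Hw Hg).
  assert (Hl : typed Gamma (lam x A b) (pi x A B)) by (eapply ty_abs; eauto).
  assert (HA : typed Gamma' (subst gamma A) (Srt TYPE)) by exact (typed_pi_dom HP).
  rewrite (subst_pi (y := y)) in *; try (eapply Fr; eauto; fail).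
  rewrite (subst_lam (y := y)); [|eapply Fr; eauto].
  eapply ty_abs; [|exact HP]; apply (IHtyping1 _ (upd gamma x (Var y))).
  + econstructor; eauto.
  + apply wtsub_upd; [now apply typed_wf in H| |].
    * now apply (wtsub_weak HA).
    * now apply ty_var with (1 := HA).
- rewrite subst_inst; simpl; rewrite <- inst_up.
  eapply ty_app; [now apply IHtyping1|now apply IHtyping2].
- eapply ty_conv; [now apply IHtyping1|now apply joinable_subst|now apply IHtyping2].
- apply typed_weak_nil; auto.
  rewrite (subst_typed_nil gamma H); now apply ty_fun.
Qed.



(** A product does not determine the bound name of its typing derivation. Stating the inversion for
    every instance of the body avoids naming it; [typed_pi_named] recovers a chosen name by
    instantiating at a variable. *)
Lemma typed_pi_inv (Gamma : env F) A B T : typed Gamma (Pi A B) T ->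
  exists s, (s = KIND -> is_kind B = true) /\
    forall Gamma' gamma a, wf Gamma' -> wtsub gamma Gamma Gamma' ->
      typed Gamma' a (subst gamma A) -> typed Gamma' (subst (scons a gamma) B) (Srt s).
Proof.
intros H; remember (Pi A B) as t eqn:E; revert A B E.
induction H; intros A0 B0 E; try discriminate; eauto.
- destruct (IHtyping2 _ _ E) as (s' & HK & Hs); exists s'; split; auto.
  intros Gamma' gamma a Hw Hg; apply Hs; auto; intros y C Hy; apply Hg; simpl; auto.
- injection E as <- <-; exists s; split.
  + intros ->; rewrite is_kind_close; now apply (typed_KIND H0).
  + intros Gamma' gamma a Hw Hg Ha; rewrite scons_close.
    apply (typed_subst H0); auto; apply wtsub_upd; auto; now apply typed_wf in H0.
Qed.

Lemma typed_pi_named (Gamma : env F) x A B T :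
  typed Gamma (pi x A B) T -> ~ In x (dom Gamma) ->
  typed Gamma A (Srt TYPE) /\ exists s, typed ((x, A) :: Gamma) B (Srt s).
Proof.
intros H Hx; assert (HA := typed_pi_dom H); split; auto.
destruct (typed_pi_inv H) as (s & _ & Hs); exists s.
rewrite <- (inst_close_same x B); apply Hs.
- econstructor; eauto; now apply typed_wf in H.
- apply (wtsub_weak HA); auto; apply wtsub_id; now apply typed_wf in H.
- rewrite subst_Var; now apply ty_var with (1 := HA).
Qed.

Lemma typed_type (Gamma : env F) t T :
  typed Gamma t T -> T = Srt KIND \/ exists s, typed Gamma T (Srt s).
Proof.
assert (HS : forall (Gamma : env F) s, wf Gamma ->
  Srt s = Srt KIND :> term F \/ exists s', typed Gamma (Srt s) (Srt s')).
{ intros G [] Hw; auto; right; exists KIND; apply typed_weak_nil; auto; apply ty_sort. }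
induction 1; eauto.
- right; exists s; now apply ty_weak with (1 := H) (2 := H).
- destruct IHtyping2 as [->|[s' Hs]]; auto; right; exists s'; now apply ty_weak with (1 := H).
- apply HS; now apply typed_wf in H.
- right; destruct IHtyping1 as [E|[s Hs]]; [discriminate|].
  destruct (typed_pi_inv Hs) as (s' & _ & H'); exists s'.
  assert (Hw := typed_wf H0); apply H'; auto; [now apply wtsub_id|now rewrite subst_Var].
Qed.

(** If only the instance were a kind, its type would be [KIND]; but the type of [t], not being
    [KIND], has a sort, and so would its instance [KIND]. *)
Lemma is_kind_typed_subst (Gamma Gamma' : env F) t T gamma :
  typed Gamma t T -> wf Gamma' -> wtsub gamma Gamma Gamma' ->
  is_kind (subst gamma t) = is_kind t.
Proof.
intros H Hw Hg; destruct (is_kind t) eqn:E; [now apply is_kind_subst|].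
destruct (is_kind (subst gamma t)) eqn:E'; auto.
assert (HT := is_kind_typed (typed_subst H Hw Hg) E').
destruct (typed_type H) as [->|[s Hs]]; [now rewrite (typed_KIND H) in E|].
assert (H' := typed_subst Hs Hw Hg); rewrite HT in H'; now apply KIND_not_typed in H'.
Qed.

Lemma is_kind_typed_inst (Gamma : env F) A B a T :
  typed Gamma (Pi A B) T -> typed Gamma a A -> is_kind (inst B a) = is_kind B.
Proof.
intros H Ha; destruct (is_kind B) eqn:E; [now apply is_kind_subst|].
destruct (is_kind (inst B a)) eqn:E'; auto.
destruct (typed_pi_inv H) as (s & HK & Hs).
assert (Hw := typed_wf Ha).
assert (H' : typed Gamma (inst B a) (Srt s)).
{ apply Hs; auto; [now apply wtsub_id|now rewrite subst_Var]. }
apply (is_kind_typed H') in E'; injection E' as ->; rewrite HK in E; auto.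
Qed.

(** Reduction keeps kinds and their arity. Conversely, if [B] reduces to a kind, preservation gives
    that kind the type of [B], which is thus [KIND], and [B] is a kind. *)
Lemma is_kind_joinable (Gamma : env F) A B s s' :
  typed Gamma A (Srt s) -> typed Gamma B (Srt s') -> joinable A B ->
  is_kind A = is_kind B /\ (is_kind A = true -> ar A = ar B).
Proof.
assert (H : forall A B s', typed Gamma B (Srt s') -> joinable A B ->
  is_kind A = true -> is_kind B = true /\ ar A = ar B).
{ intros A0 B0 s0 HB [C [H1 H2]] E; destruct (is_kind_redst E H1) as [EC <-].
  assert (HC := is_kind_typed (typed_reds HB H2) EC).
  rewrite HC in HB; apply typed_KIND in HB; auto; split; auto.
  now destruct (is_kind_redst HB H2). }
intros HA HB HJ; assert (HJ' : joinable B A) by (destruct HJ as [C []]; exists C; auto).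
split; [|intros E; now apply (H A B s')].
destruct (is_kind A) eqn:EA; [symmetry; now apply (H A B s')|].
destruct (is_kind B) eqn:EB; auto; rewrite <- EA; now apply (H B A s).
Qed.

(** ** Telescopes *)

(** The environments are located up to inclusion, because a telescope lists its declarations in the
    order opposite to an environment. *)
Lemma typed_pis (Gamma : env F) G V T : typed Gamma (pis G V) T ->
  NoDup (dom G) -> (forall x, In x (dom G) -> ~ In x (dom Gamma)) ->
  (forall y U, In (y, U) G ->
     exists Gamma1, incl Gamma1 (G ++ Gamma) /\ typed Gamma1 U (Srt TYPE)) /\
  exists Gamma1 T', incl Gamma1 (G ++ Gamma) /\ typed Gamma1 V T'.
Proof.
revert Gamma T; induction G as [|[x A] G IH]; simpl; intros Gamma T H Nd Hd.
- split; [tauto|]; exists Gamma, T; split; auto; apply incl_refl.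
- inversion Nd as [|? ? Hx Nd']; subst.
  destruct (typed_pi_named H) as [HA [s HB]]; [now apply Hd; auto|].
  destruct (IH _ _ HB) as [H1 H2]; auto.
  { intros y Hy [E|Hy']; [simpl in E; subst; contradiction|]; apply (Hd y); auto. }
  assert (HI : forall G1, incl G1 (G ++ (x, A) :: Gamma) -> incl G1 ((x, A) :: G ++ Gamma)).
  { intros G1 HI u Hu; apply HI, in_app_or in Hu; simpl in *.
    destruct Hu as [Hu|[Hu|Hu]]; auto; right; apply in_or_app; auto. }
  split.
  + intros y U [E|Hy].
    * injection E as <- <-; exists Gamma; split; auto.
      intros u Hu; right; apply in_or_app; auto.
    * destruct (H1 y U Hy) as (G1 & ? & ?); exists G1; auto.
  + destruct H2 as (G1 & T' & ? & ?); exists G1, T'; auto.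
Qed.

Lemma typed_telescope (T : term F) G V s :
  typed [] T s -> telescope T G V ->
  (forall y U, In (y, U) G ->
     exists Gamma, incl Gamma G /\ typed Gamma U (Srt TYPE)) /\
  exists Gamma T', incl Gamma G /\ typed Gamma V T'.
Proof.
intros H (-> & Nd & _); destruct (typed_pis H Nd) as [H1 H2]; [auto|].
rewrite app_nil_r in H1, H2; auto.
Qed.

Lemma typed_apps (Gamma : env F) h gamma G V :
  typed Gamma h (subst gamma (pis G V)) ->
  (forall y U, In (y, U) G -> typed Gamma (gamma y) (subst gamma U)) ->
  typed Gamma (apps h (map gamma (dom G))) (subst gamma V).
Proof.
revert h; induction G as [|[x A] G IH]; simpl; intros h H HG; auto.
apply IH; auto; rewrite <- (inst_pis G x V).
eapply ty_app; [exact H|exact (HG x A (or_introl eq_refl))].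
Qed.

(** A judgment of [typed_call] in an ill-formed environment does not use it:
    its subject and its type are closed. *)
Definition wf_part (Gamma Gamma' : env F) : Prop :=
  wf Gamma /\ Gamma' = Gamma \/ ~ wf Gamma /\ Gamma' = [].

Lemma wf_part_exists Gamma : exists Gamma', wf_part Gamma Gamma'.
Proof. unfold wf_part; destruct (classic (wf Gamma)); eauto. Qed.

Lemma wf_part_wf Gamma Gamma' : wf_part Gamma Gamma' -> wf Gamma'.
Proof. intros [[H ->]|[_ ->]]; auto; constructor. Qed.

Lemma wf_part_eq Gamma Gamma' : wf Gamma -> wf_part Gamma Gamma' -> Gamma' = Gamma.
Proof. intros H [[_ ->]|[H' _]]; auto; contradiction. Qed.

Lemma close_closed x y (t : term F) : (forall z, ~ free z t) -> close x t = close y t.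
Proof.
intros H; unfold close; rewrite !ren_as_subst; apply subst_ext_free; intros z Hz; now apply H in Hz.
Qed.

(** If the extended environment is well formed, the name [x] is kept. Otherwise [B] and [T] are
    closed, the binder is vacuous, and any fresh name will do. *)
Lemma wf_part_bind Gamma Gamma' x A B T :
  wf_part Gamma Gamma' -> typed Gamma' A (Srt TYPE) ->
  (forall Gamma2, wf_part ((x, A) :: Gamma) Gamma2 -> typed Gamma2 B T) ->
  exists y B' T', close x B = close y B' /\ close x T = close y T' /\
    typed ((y, A) :: Gamma') B' T' /\ (forall s, T = Srt s -> T' = Srt s).
Proof.
intros HG HA HB; destruct (classic (wf ((x, A) :: Gamma))) as [Hw|Hw].
- destruct (wf_cons_inv Hw) as [Hw' _]; assert (EG := wf_part_eq Hw' HG); subst Gamma'.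
  exists x, B, T; repeat split; auto; apply HB; left; auto.
- assert (H : typed [] B T) by (apply HB; right; auto).
  destruct (fresh_name (dom Gamma')) as [y Hy]; exists y, B, T.
  split; [|split; [|split]]; auto.
  + apply close_closed; intros z Hz; now apply (typed_free H) in Hz.
  + apply close_closed; intros z Hz; apply (typed_free_both (x := z) H); auto.
  + eapply ty_weak; eauto; apply typed_weak_nil; auto; now apply wf_part_wf in HG.
Qed.

(** Ill-formed environments originate in [tc_dp]: for a call without arguments, no premise
    constrains [Gamma]. Typing itself comes from [ty_fun] followed by applications. *)
Lemma typed_call_typed f ls Gamma (t T : term F) :
  typed_call f ls Gamma t T -> forall Gamma', wf_part Gamma Gamma' -> typed Gamma' t T.
Proof.
induction 1; intros Gamma' HG.
- rewrite (wf_part_eq wf_nil HG); apply ty_sort.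
- apply typing_typed in H.
  assert (Hw : wf ((x, A) :: Gamma)) by (econstructor; eauto; now apply typed_wf in H).
  rewrite (wf_part_eq Hw HG); now apply ty_var with (1 := H).
- apply typing_typed in H; assert (Hw' := typed_wf H).
  assert (Hw : wf ((x, A) :: Gamma)) by (econstructor; eauto).
  rewrite (wf_part_eq Hw HG); eapply ty_weak; eauto; apply IHtyped_call; left; auto.
- assert (HA := IHtyped_call1 _ HG).
  destruct (wf_part_bind HG HA IHtyped_call2) as (y & B' & T' & EB & _ & HB & ET).
  rewrite (ET s eq_refl) in HB; unfold pi; rewrite EB; eapply ty_prod; eauto.
- apply typing_typed in H1.
  assert (EG := wf_part_eq (typed_wf H1) HG); subst Gamma'.
  assert (HA := typed_pi_dom H1).
  destruct (wf_part_bind HG HA IHtyped_call) as (y & B' & T' & EB & ET & HB & _).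
  unfold pi, lam in *; rewrite EB, ET in *; eapply ty_abs; eauto.
- apply typing_typed in H1; assert (EG := wf_part_eq (typed_wf H1) HG); subst Gamma'.
  exact (ty_app (IHtyped_call1 _ HG) (IHtyped_call2 _ HG)).
- apply typing_typed in H1; assert (EG := wf_part_eq (typed_wf H1) HG); subst Gamma'.
  exact (ty_conv (IHtyped_call _ HG) H0 H1).
- apply typing_typed in H1; assert (Hw := wf_part_wf HG).
  unfold fapps; apply typed_apps; [|intros; apply (H3 y U); auto].
  destruct H as [E _]; rewrite <- E, (subst_typed_nil gamma H1).
  apply typed_weak_nil; auto; now apply ty_fun.
- apply typing_typed in H0; rewrite (wf_part_eq wf_nil HG); now apply ty_fun.
Qed.

(** * Adequacy *)

Lemma sem_ext (V : Type) (T : tm F V) (sigma tau : V -> term F) t :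
  (forall x, free x T -> sigma x = tau x) -> (sem T sigma t <-> sem T tau t).
Proof.
assert (H : forall (V : Type) (T : tm F V) (sigma tau : V -> term F) t,
  (forall x, free x T -> sigma x = tau x) ->
  (sem_type (subst sigma T) t <-> sem_type (subst tau T) t)).
{ intros V0 T0 s0 t0 t1 E; now rewrite (subst_ext_free E). }
revert sigma tau t; induction T; intros sigma tau t E;
  [reflexivity| | | | |]; try exact (H _ _ _ _ t E).
simpl sem; destruct (is_kind T2); [clear H|exact (H _ _ _ _ t E)].
unfold Pi_set; simpl in E; split; intros H a Ha.
- rewrite <- (IHT2 (scons a sigma)); [|intros [x|]; simpl; auto].
  apply H; rewrite (IHT1 sigma tau); auto.
- rewrite (IHT2 (scons a sigma) (scons a tau)); [|intros [x|]; simpl; auto].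
  apply H; rewrite <- (IHT1 sigma tau); auto.
Qed.

Definition type_sem (T : term F) (sigma : name -> term F) : term F -> Prop :=
  arity_sem (kd T) (ar T) (subst sigma T).

(** Requiring the type to be in [Dcal] strengthens adequacy enough that the default value of
    [sem_type] never arises. *)
Definition reducible (sigma : name -> term F) (t T : term F) : Prop :=
  D (subst sigma T) /\ type_sem T sigma (subst sigma t).

(** Nothing is asked in an ill-formed environment, which [typed_call] allows. *)
Definition valid (sigma : name -> term F) (Gamma : env F) : Prop :=
  wf Gamma -> models sigma Gamma.

(** Used to read an instance through the arity of the type before substitution: the number of
    products must be exact for kinds only. *)
Lemma type_sem_arity_sem b n (T : term F) sigma h :
  D (subst sigma T) -> kd T = b -> n <= ar (subst sigma T) -> (b = true -> ar T = n) ->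
  (type_sem T sigma h <-> arity_sem b n (subst sigma T) h).
Proof.
intros HD <- Hn HE; unfold type_sem; destruct (kd T).
- now rewrite HE.
- rewrite !arity_sem_false; auto; [reflexivity|apply ar_subst].
Qed.

Lemma type_sem_I (T : term F) sigma h :
  D (subst sigma T) -> kd T = false -> (type_sem T sigma h <-> I (subst sigma T) h).
Proof.
intros HD E; rewrite (type_sem_arity_sem (b := false) (n := 0)); auto; try discriminate; [reflexivity|lia].
Qed.

Lemma cand_type_sem (T : term F) sigma : D (subst sigma T) -> cand (type_sem T sigma).
Proof. intros H; apply cand_arity_sem; auto; apply ar_subst. Qed.

Lemma valid_upd sigma (Gamma : env F) x A a :
  valid sigma Gamma -> kd A = false -> wk A -> D (subst sigma A) -> I (subst sigma A) a ->
  valid (upd sigma x a) ((x, A) :: Gamma).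
Proof.
intros HG EA WA HD Ha Hw y B Hy.
destruct (wf_cons_inv Hw) as (HwG & _ & HA & HB); destruct Hy as [E|Hy].
- injection E as <- <-; rewrite upd_same.
  apply (sem_ext (sigma := sigma)); [intros z Hz; rewrite upd_other; congruence|].
  apply sem_arity_sem; auto; now apply type_sem_I.
- destruct (HB y B Hy) as [Hyx Hf]; rewrite upd_other; auto.
  apply (sem_ext (sigma := sigma)); [intros z Hz; rewrite upd_other; congruence|].
  now apply HG.
Qed.

Lemma valid_tail sigma (Gamma : env F) x A s :
  typed Gamma A (Srt s) -> ~ In x (dom Gamma) -> valid sigma ((x, A) :: Gamma) ->
  valid sigma Gamma.
Proof.
intros HA Hx H Hw y B Hy; apply H; simpl; auto; econstructor; eauto.
Qed.

Lemma reducible_var sigma (Gamma : env F) x A s :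
  typed Gamma A (Srt s) -> ~ In x (dom Gamma) -> valid sigma ((x, A) :: Gamma) ->
  D (subst sigma A) -> reducible sigma (Var x) A.
Proof.
intros HA Hx H HD; split; auto; apply sem_arity_sem; auto; [now apply typed_wk in HA|].
apply H; simpl; auto; econstructor; eauto; now apply typed_wf in HA.
Qed.

Lemma reducible_sort sigma (t : term F) s : reducible sigma t (Srt s) <-> D (subst sigma t).
Proof.
unfold reducible, type_sem; simpl; split; [tauto|]; split; auto; apply D_srt.
Qed.

Lemma reducible_D sigma (t : term F) s : reducible sigma t (Srt s) -> D (subst sigma t).
Proof. apply reducible_sort. Qed.

Lemma D_subst_pi sigma x (A B : term F) :
  D (subst sigma A) -> (forall a, I (subst sigma A) a -> D (subst (upd sigma x a) B)) ->
  D (subst sigma (pi x A B)).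
Proof.
intros HA HB.
assert (E : forall a, inst (subst (up sigma) (close x B)) a = subst (upd sigma x a) B).
{ intros a; now rewrite inst_up, scons_close. }
apply D_pi; auto.
- apply sn_pi; [now apply D_sn|].
  (* Variables belong to every candidate. Capture of [Var 0] is no concern: termination of any
     instance gives that of the body. *)
  apply (sn_subst (sigma := scons (Var 0) Var)).
  change (sn (inst (subst (up sigma) (close x B)) (Var 0))).
  rewrite E; apply D_sn, HB, cand_var; now apply cand_I.
- intros a Ha; rewrite E; auto.
Qed.

(** The redex is neutral, so its reducts suffice: the contractum is in [Q a] by assumption, and the
    others are covered by a triple induction on the termination of [A], [b] and [a]. *)
Lemma beta_expansion (P : term F -> Prop) (Q : term F -> term F -> Prop) A b a :
  cand P -> (forall a, P a -> cand (Q a)) ->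
  (forall a a' t, P a -> red a a' -> Q a' t -> Q a t) ->
  sn A -> (forall a, P a -> Q a (inst b a)) -> P a -> Q a (App (Lam A b) a).
Proof.
intros HP HQ HE HA Hb Ha.
assert (Hsb : sn b).
{ assert (Hx := cand_var 0 HP).
  apply (sn_subst (sigma := scons (Var 0) Var)); now apply (HQ _ Hx), Hb. }
assert (Hsa : sn a) by now apply HP.
revert b Hsb Hb a Hsa Ha; induction HA as [A _ IHA].
intros b Hsb; induction Hsb as [b Hsb IHb].
intros Hb a Hsa; induction Hsa as [a Hsa IHa].
intros Ha; apply (proj2 (proj2 (HQ a Ha))).
- repeat split; try discriminate.
  intros rho us _ E; apply app_fapps in E as (vs & _ & E); symmetry in E; now apply fapps_not_lam in E.
- intros u Hu; apply red_inv in Hu as [(A' & b' & a' & E & ->)|[(rho & s & _ & E & _)|H]].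
  + injection E as <- <- <-; auto.
  + apply app_fapps in E as (vs & _ & E); symmetry in E; now apply fapps_not_lam in E.
  + destruct H as [(t' & -> & H)|(a' & -> & H)].
    * apply red_lam_inv in H as [(A' & -> & H)|(b' & -> & H)].
      -- apply IHA; auto; constructor; auto.
      -- apply IHb; auto; [|constructor; auto].
         intros c Hc; apply (proj1 (proj2 (HQ c Hc)) (inst b c)); auto; now apply red_subst.
    * apply HE with a'; auto; apply IHa; auto; now apply (proj1 (proj2 HP) a).
Qed.

Lemma reducible_abs sigma x (A B b : term F) :
  kd B = is_kind B -> D (subst sigma (pi x A B)) ->
  (forall a, I (subst sigma A) a -> type_sem B (upd sigma x a) (subst (upd sigma x a) b)) ->
  reducible sigma (lam x A b) (pi x A B).
Proof.
intros EK HD Hb; split; auto; intros A' B' E a Ha; simpl in E; injection E as <- <-.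
change (D (Pi (subst sigma A) (subst (up sigma) (close x B)))) in HD.
destruct (D_pi_inv HD) as [HA HB].
assert (Har : forall a, ar (close x B) <= ar (inst (subst (up sigma) (close x B)) a)).
{ intros c; rewrite inst_up; apply ar_subst. }
apply (beta_expansion (P := I (subst sigma A))
  (Q := fun a => arity_sem (is_kind (close x B)) (ar (close x B)) (inst (subst (up sigma) (close x B)) a))); auto.
- now apply cand_I.
- intros c Hc; apply cand_arity_sem; auto.
- intros c c' t Hc Ec; apply arity_sem_redst; auto; apply inst_redst; [apply rt_refl|now apply rt_step].
- now apply D_sn.
- intros c Hc; specialize (Hb c Hc); unfold type_sem in Hb.
  rewrite !inst_up, !scons_close, is_kind_close, <- EK.
  unfold close; rewrite ar_ren; exact Hb.
Qed.

Lemma reducible_app sigma (Gamma : env F) t a A B T :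
  typed Gamma (Pi A B) T -> typed Gamma a A ->
  reducible sigma t (Pi A B) -> reducible sigma a A ->
  reducible sigma (App t a) (inst B a).
Proof.
intros HP Ha [HD Ht] [HDA HaA].
assert (EA := typed_TYPE_kd (typed_pi_dom HP)).
apply (type_sem_I _ HDA EA) in HaA.
change (D (Pi (subst sigma A) (subst (up sigma) B))) in HD.
destruct (D_pi_inv HD) as [_ HB]; specialize (HB _ HaA).
assert (E : inst (subst (up sigma) B) (subst sigma a) = subst sigma (inst B a)).
{ now rewrite inst_up, subst_inst. }
assert (EK := is_kind_typed_inst HP Ha).
rewrite E in HB; split; auto.
(* [inst B a] may have more products than [B], but not when [B] is a kind. *)
apply (type_sem_arity_sem (b := is_kind B) (n := ar B)); auto.
- rewrite <- EK; apply kindless_kd.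
  destruct (typed_kindless HP) as [[_ ?] _]; destruct (typed_kindless Ha) as [? _].
  now apply kindless_inst.
- rewrite <- E, inst_up; apply ar_subst.
- intros EB; now apply is_kind_subst.
- rewrite <- E; exact (Ht _ _ eq_refl _ HaA).
Qed.

Lemma reducible_conv sigma (Gamma : env F) a A B s s' :
  typed Gamma A (Srt s) -> typed Gamma B (Srt s') -> joinable A B ->
  D (subst sigma B) -> reducible sigma a A -> reducible sigma a B.
Proof.
intros HA HB HJ HD [HDA Ha]; split; auto.
destruct (is_kind_joinable HA HB HJ) as [EK Ear].
assert (EA := typed_kd HA); assert (EB := typed_kd HB).
destruct (joinable_subst sigma HJ) as (C & H1 & H2).
destruct (is_kind A) eqn:E.
- unfold type_sem in *; rewrite EB, <- EK, <- Ear; auto; rewrite EA in Ha.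
  assert (L := ar_subst sigma B); rewrite <- Ear in L; auto.
  apply (arity_sem_redst true (subst sigma a) L HD H2).
  apply (arity_sem_redst true (subst sigma a) (ar_subst sigma A) HDA H1); auto.
- apply type_sem_I; auto; [congruence|]; apply (type_sem_I _ HDA) in Ha; auto.
  apply (I_redst _ H2 HD); now apply (I_redst _ H1 HDA).
Qed.

(** Both hypotheses occur in [Cset]. Adequacy discharges them from the typing premise of the rule
    for symbols. *)
Definition sound (f : F) : Prop :=
  typed [] (Theta f) (Srt (sort_of f)) -> D (Theta f) ->
  arity_sem (kd (Theta f)) (ar (Theta f)) (Theta f) (Fun f).

(** Adequacy relative to the symbols allowed by [ok]: with those below [f] it serves inside the
    induction on the precedence, with all symbols it gives the final result. *)
Lemma typing_reducible (ok : F -> Prop) : (forall f, ok f -> sound f) ->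
  forall Gamma t T, typing ok Gamma t T ->
  forall sigma, valid sigma Gamma -> reducible sigma t T.
Proof.
intros Hok; induction 1; intros sigma Hs;
  repeat match goal with H : typing ok _ _ _ |- _ => apply typing_typed in H end.
- apply reducible_sort, D_srt.
- apply (reducible_var H H0 Hs), (@reducible_D sigma A s), IHtyping.
  exact (valid_tail H H0 Hs).
- apply IHtyping2; exact (valid_tail H H1 Hs).
- apply reducible_sort.
  assert (HA : D (subst sigma A)) by now apply (@reducible_D sigma A TYPE), IHtyping1.
  apply D_subst_pi; auto; intros a Ha.
  apply (@reducible_D (upd sigma x a) B s), IHtyping2, valid_upd; auto.
  + exact (typed_TYPE_kd H).
  + exact (typed_wk H).
- assert (HP : D (subst sigma (pi x A B))) by now apply (@reducible_D sigma (pi x A B) s), IHtyping2.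
  assert (HA := typed_pi_dom H0).
  apply reducible_abs; auto.
  + apply kindless_kd; apply typed_kindless in H0 as [[_ H0] _]; now apply kindless_ren in H0.
  + intros a Ha; apply IHtyping1, valid_upd; auto.
    * exact (typed_TYPE_kd HA).
    * exact (typed_wk HA).
    * now destruct (D_pi_inv HP).
- destruct (typed_type H) as [E|[s HP]]; [discriminate|].
  apply (reducible_app HP H0); auto.
- destruct (typed_type H) as [E|[s' HA]]; [subst; now apply (KIND_not_joinable H0) in H1|].
  apply (reducible_conv HA H1 H0); auto; now apply (@reducible_D sigma B s), IHtyping2.
- assert (HD : D (subst sigma (Theta f))) by now apply (@reducible_D sigma (Theta f) (sort_of f)), IHtyping.
  split; auto; unfold type_sem; rewrite (subst_typed_nil sigma H) in *; now apply Hok.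
Qed.

(** * Soundness of the symbols *)

Lemma telescope_models (f : F) G V tau :
  typed [] (Theta f) (Srt (sort_of f)) -> D (Theta f) -> telescope (Theta f) G V ->
  (tele (Theta f) (map tau (dom G)) <-> models tau G) /\
  rest (Theta f) (map tau (dom G)) = subst tau V.
Proof.
intros HT HD HG; assert (E := subst_typed_nil tau HT).
destruct (typed_telescope HT HG) as [HU _]; destruct HG as [EG _].
rewrite <- E in HD |- *; rewrite EG in HD |- *; split; [|apply rest_pis].
apply tele_pis; auto; intros y U Hy; destruct (HU y U Hy) as (G1 & _ & H).
exact (typed_TYPE_kd H).
Qed.

(** In the rule for dependency pairs, the types of the arguments and of the result are
    instances of typable types, so that [gamma] does not turn a type into a kind. *)
Lemma typed_call_reducible f ls (sigma0 : name -> term F) :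
  (forall g : F, gt f g -> sound g) -> (forall g : F, ~ defined g -> sound g) ->
  (forall (g : F) G V (tau gamma sigma : name -> term F), telescope (Theta g) G V ->
     dep_pair f ls g (map gamma (dom G)) ->
     (forall x, free x (fapps f ls) -> sigma x = sigma0 x) ->
     tau = (fun y => subst sigma (gamma y)) ->
     typed [] (Theta g) (Srt (sort_of g)) -> D (Theta g) ->
     tele (Theta g) (map tau (dom G)) ->
     arity_sem (kd V) (ar V) (subst tau V) (fapps g (map tau (dom G)))) ->
  forall Gamma t T, typed_call f ls Gamma t T ->
  forall sigma, (forall x, free x (fapps f ls) -> sigma x = sigma0 x) ->
  valid sigma Gamma -> reducible sigma t T.
Proof.
intros Hlt Hund Hdp; induction 1; intros sigma E0 Hs.
- apply reducible_sort, D_srt.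
- assert (HA := typing_reducible Hlt H).
  apply typing_typed in H; apply (reducible_var H H0 Hs), (@reducible_D sigma A s), HA.
  exact (valid_tail H H0 Hs).
- apply typing_typed in H; apply IHtyped_call; auto; exact (valid_tail H H1 Hs).
- apply reducible_sort.
  assert (HA : D (subst sigma A)) by now apply (@reducible_D sigma A TYPE), IHtyped_call1.
  destruct (wf_part_exists Gamma) as [Gamma' HG].
  assert (HA' := typed_call_typed H0 HG).
  apply D_subst_pi; auto; intros a Ha.
  apply (@reducible_D (upd sigma x a) B s), IHtyped_call2.
  (* The side condition of [tc_prod] keeps the bound name out of the left-hand side, so the updated
     substitution still agrees with [sigma0] there. *)
  + intros y Hy; rewrite upd_other; auto; congruence.
  + apply valid_upd; auto; [exact (typed_TYPE_kd HA')|exact (typed_wk HA')].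
- assert (HP : D (subst sigma (pi x A B))).
  { exact (reducible_D (typing_reducible Hlt H1 Hs)). }
  apply typing_typed in H1; assert (HA := typed_pi_dom H1).
  apply reducible_abs; auto.
  + apply kindless_kd; apply typed_kindless in H1 as [[_ H1] _]; now apply kindless_ren in H1.
  + intros a Ha; apply IHtyped_call.
    * intros y Hy; rewrite upd_other; auto; congruence.
    * apply valid_upd; auto; [exact (typed_TYPE_kd HA)|exact (typed_wk HA)|].
      now destruct (D_pi_inv HP).
- apply typing_typed in H1.
  assert (Ha := typed_call_typed H0 (or_introl (conj (typed_wf H1) eq_refl))).
  apply (reducible_app H1 Ha); auto.
- assert (HB := typing_reducible Hlt H1 Hs).
  apply typing_typed in H1, H2.
  apply (reducible_conv H2 H1 H0); auto; exact (reducible_D HB).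
- assert (HD : D (Theta g)).
  { assert (HD := typing_reducible Hlt H1 (sigma := Var)).
    apply typing_typed in H1; rewrite <- (subst_typed_nil Var H1).
    apply (@reducible_D Var (Theta g) (sort_of g)), HD; intros _ y U []. }
  apply typing_typed in H1.
  set (tau := fun y => subst sigma (gamma y)).
  destruct (wf_part_exists Gamma) as [Gamma' HG]; assert (Hw := wf_part_wf HG).
  destruct (typed_telescope H1 H) as [HU (G1 & T' & HG1 & HV)].
  assert (Hg : wtsub gamma G Gamma').
  { intros y U Hy; exact (typed_call_typed (H2 y U Hy) HG). }
  destruct (telescope_models tau H1 HD H) as [Htele Hrest].
  assert (Ht : tele (Theta g) (map tau (dom G))).
  { apply Htele; intros y U Hy; destruct (HU y U Hy) as (G2 & HG2 & HU2).
    assert (EU := typed_TYPE_kd HU2).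
    destruct (H3 y U Hy sigma E0 Hs) as [HDU HXU].
    assert (EU' : kd (subst gamma U) = false).
    { apply (typed_TYPE_kd (Gamma := Gamma')), (typed_subst HU2 (gamma := gamma)); auto.
      intros z C Hz; now apply Hg, HG2. }
    apply (type_sem_I _ HDU EU') in HXU; rewrite subst_subst in HDU, HXU.
    apply sem_arity_sem; auto; [exact (typed_wk HU2)|]; now apply type_sem_I. }
  assert (HDV : D (subst tau V)) by (rewrite <- Hrest; now apply tele_D).
  assert (Hg1 : wtsub gamma G1 Gamma') by (intros z C Hz; now apply Hg, HG1).
  assert (EV : kd (subst gamma V) = kd V).
  { rewrite (typed_kd (typed_subst HV Hw Hg1)), (typed_kd HV).
    exact (is_kind_typed_subst HV Hw Hg1). }
  assert (HX := Hdp g G V tau gamma sigma H H0 E0 eq_refl H1 HD Ht).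
  assert (ET : subst sigma (subst gamma V) = subst tau V) by apply subst_subst.
  split; [now rewrite ET|].
  apply (type_sem_arity_sem (b := kd V) (n := ar V)); auto.
  + now rewrite ET.
  + rewrite ET; apply ar_subst.
  + rewrite (typed_kd HV); apply is_kind_subst.
  + rewrite ET, subst_fapps, map_map; exact HX.
- assert (HD : D (Theta g)).
  { assert (HD := typing_reducible Hlt H0 Hs).
    apply typing_typed in H0; rewrite <- (subst_typed_nil sigma H0).
    now apply (@reducible_D sigma (Theta g) (sort_of g)). }
  apply typing_typed in H0.
  unfold reducible, type_sem; rewrite (subst_typed_nil sigma H0); split; auto.
  now apply Hund.
Qed.

(** [ts] is a list of arguments for which [fapps f ts] belongs to [Cset]. *)
Definition arguments (f : F) (ts : list (term F)) : Prop :=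
  typed [] (Theta f) (Srt (sort_of f)) /\ D (Theta f) /\
  length ts = ar (Theta f) /\ tele (Theta f) ts.

Lemma arguments_Cset f ts : arguments f ts -> Cset (fapps f ts).
Proof.
intros (HT & HD & El & Ht); exists f, ts; repeat (split; auto).
intros G U HG EG; destruct (telescope_models (assign (dom G) ts) HT HD HG) as [H _].
apply H; rewrite map_assign; auto; [apply HG|].
unfold dom; now rewrite length_map, EG.
Qed.

Lemma arguments_redst f ts ts' : arguments f ts -> Forall2 redst ts ts' ->
  arguments f ts' /\ redst (rest (Theta f) ts) (rest (Theta f) ts').
Proof.
intros (HT & HD & El & Ht) H.
destruct (tele_redst HD (rt_refl _ _ _) H Ht) as [H1 H2].
split; auto; split; [|split; [|split]]; auto.
exact (eq_trans (eq_sym (Forall2_length H)) El).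
Qed.

Lemma arguments_D f ts : arguments f ts -> D (rest (Theta f) ts).
Proof. intros (HT & HD & El & Ht); now apply tele_D. Qed.

Lemma arguments_arity_sem b f ts ts' h : arguments f ts -> Forall2 redst ts ts' ->
  arity_sem b 0 (rest (Theta f) ts') h -> arity_sem b 0 (rest (Theta f) ts) h.
Proof.
intros H H'; destruct (arguments_redst H H') as [_ E]; apply arity_sem_redst; auto; [lia|].
now apply arguments_D.
Qed.

Lemma Forall2_redst_trans (ts us vs : list (term F)) :
  Forall2 redst ts us -> Forall2 redst us vs -> Forall2 redst ts vs.
Proof.
intros H; revert vs; induction H; intros vs H'; inversion H'; subst; constructor; auto.
eapply rt_trans; eauto.
Qed.

Lemma Forall2_redst_refl (ts : list (term F)) : Forall2 redst ts ts.
Proof. induction ts; constructor; auto; apply rt_refl. Qed.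

(** A fully applied symbol is neutral: it suffices to consider the rules that
    apply at its root after some reductions of the arguments. *)
Lemma symbol_expansion b f ts :
  (forall rho : rule F, rules rho -> length (args rho) <= ar (Theta (head rho))) ->
  arguments f ts ->
  (forall rho sigma us, rules rho -> head rho = f ->
     Forall2 redst ts (map (subst sigma) (args rho) ++ us) ->
     arity_sem b 0 (rest (Theta f) (map (subst sigma) (args rho) ++ us)) (apps (subst sigma (rhs rho)) us)) ->
  arity_sem b 0 (rest (Theta f) ts) (fapps f ts).
Proof.
intros Har Harg; assert (Hs : Forall sn ts).
{ destruct Harg as (_ & HD & _ & Ht); now apply (tele_sn HD). }
apply reds1_Acc in Hs; induction Hs as [ts _ IH]; intros Hroot.
assert (HC : cand (arity_sem b 0 (rest (Theta f) ts))).
{ apply cand_arity_sem; auto; [lia|now apply arguments_D]. }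
apply HC.
- repeat split.
  + intros A c; apply fapps_not_lam.
  + intros A B; apply fapps_not_pi.
  + intros rho us Hr E; apply fapps_inj in E as [-> ->].
    destruct Harg as (_ & _ & El & _); exact (eq_ind_r (fun n => _ <= n) (Har rho Hr) El).
- intros u Hu; apply red_fapps in Hu as [(ts' & E & ->)|(rho & sigma & us & Hr & Hh & -> & ->)].
  (* The type [rest (Theta f) ts] contains the arguments and reduces with them; the membership is
     carried back to the original type. *)
  + assert (E' := reds1_redst E); apply (arguments_arity_sem Harg E'); apply IH; auto.
    * now apply (arguments_redst Harg E').
    * intros rho sigma us Hr Hh H; apply Hroot; auto; eapply Forall2_redst_trans; eauto.
  + apply Hroot; auto; apply Forall2_redst_refl.
Qed.

(** * Soundness by induction on the precedence and on calls *)

Lemma sound_arguments f :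
  (forall ts, arguments f ts -> arity_sem (kd (Theta f)) 0 (rest (Theta f) ts) (fapps f ts)) -> sound f.
Proof.
intros H HT HD; apply arity_sem_apps; auto; intros ts El Ht; apply H; repeat (split; auto).
Qed.

Lemma sound_undefined f :
  (forall rho : rule F, rules rho -> length (args rho) <= ar (Theta (head rho))) ->
  ~ defined f -> sound f.
Proof.
intros Har Hf; apply sound_arguments; intros ts Hts; apply symbol_expansion; auto.
intros rho sigma us Hr Hh; elim Hf; exists rho; auto.
Qed.

Lemma call_in_sym (avoid : name -> Prop) (g : F) ms us t :
  call_in avoid g ms us t -> sym_in g t.
Proof.
assert (Hc : forall x (B : term F), sym_in g B -> sym_in g (close x B)).
{ intros x B; unfold close.
  enough (H : forall V (B : tm F V) W (h : V -> W), sym_in g B -> sym_in g (ren h B)) by apply H.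
  clear; induction B; intros W h; simpl; auto; intros [H|H]; auto. }
induction 1; simpl; auto.
Qed.

Lemma dep_pair_geq (f : F) ls g ms : dep_pair f ls g ms -> geq f g.
Proof.
intros (r & Hr & _ & H); apply rt_step; right; exists (Rule f ls r); repeat split; auto.
now apply call_in_sym in H.
Qed.

Lemma gt_geq (f g h : F) : geq f g -> gt g h -> gt f h.
Proof.
intros H [H1 H2]; split; [eapply rt_trans; eauto|].
intros H3; apply H2; eapply rt_trans; eauto.
Qed.

Lemma Forall2_firstn_map (ts ls us : list (term F)) (sigma : name -> term F) :
  Forall2 redst ts (map (subst sigma) ls ++ us) ->
  length ls <= length ts /\
  Forall2 (fun t l => reds t (subst sigma l)) (firstn (length ls) ts) ls.
Proof.
revert ts; induction ls as [|l ls IH]; simpl; intros ts H; [split; [lia|constructor]|].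
inversion H as [|t ? ts' ? Ht Hts]; subst; destruct (IH _ Hts); simpl; split; [lia|].
constructor; auto.
Qed.

Lemma symbols_sound (Delta : rule F -> env F) :
  well_structured Delta -> accessible Delta -> call_terminates S ->
  forall f, sound f.
Proof.
intros (Hwf & Har & _ & Hty) Hacc Hterm.
assert (Hund : forall g : F, ~ defined g -> sound g) by (intros; now apply sound_undefined).
(* The head symbol changes along calls, possibly within one equivalence class of the precedence. The
   claim therefore ranges over all [f] and carries the soundness of the symbols below. *)
assert (Hmain : forall u, Acc (fun v u => @call S u v) u -> forall f ts, u = fapps f ts ->
  (forall g : F, gt f g -> sound g) -> arguments f ts ->
  arity_sem (kd (Theta f)) 0 (rest (Theta f) ts) (fapps f ts)).
{ induction 1 as [u _ IHcall]; intros f ts -> Hlt Harg.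
  apply symbol_expansion; auto.
  intros [f' ls r] sigma us Hr Hh Hred; cbn [head args rhs] in *; subst f'.
  assert (Harg' := proj1 (arguments_redst Harg Hred)).
  assert (HT := proj1 Harg); assert (HD := proj1 (proj2 Harg)).
  destruct Harg' as (_ & _ & El & Htele); apply tele_app in Htele as [Htele1 Htele2].
  destruct (telescope_exists (Har _ Hr)) as (G & U & HG & EG); simpl in HG, EG.
  assert (Edom : length (dom G) = length ls) by (unfold dom; now rewrite length_map).
  assert (Nd : NoDup (dom G)) by apply HG.
  pose (pi := assign (dom G) ls).
  pose (tau := assign (dom G) (map (subst sigma) ls)).
  assert (Emap : map tau (dom G) = map (subst sigma) ls).
  { apply map_assign; auto; now rewrite length_map. }
  destruct (telescope_models tau HT HD HG) as [Hmod Hrest]; rewrite Emap in Hmod, Hrest.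
  assert (Hsig : models sigma (Delta (Rule f ls r))).
  { apply (Hacc sigma (Rule f ls r) Hr G U HG EG HT HD); now apply Hmod. }
  assert (Hr' := Hty _ Hr G U HG EG); simpl in Hr'; fold pi in Hr'.
  assert (Hred' : reducible sigma r (subst pi U)).
  { refine (typed_call_reducible (sigma0 := sigma) Hlt Hund _ Hr' (fun _ _ => eq_refl)
      (fun _ => Hsig)).
    intros g G' V tau' gamma sigma' HG' Hdep Eq Etau HTg HDg Htg.
    (* A dependency pair may give [g] fewer arguments than its arity. Completing them by arbitrary
       [vs] yields a member of [Cset], to which the induction on calls applies. *)
    apply arity_sem_apps; auto; [apply ar_subst|]; intros vs Ev Hv.
    destruct (telescope_models tau' HTg HDg HG') as [_ Hrest']; rewrite <- Hrest' in Hv |- *.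
    rewrite <- rest_app; unfold fapps; rewrite <- apps_app; fold (fapps g (map tau' (dom G') ++ vs)).
    assert (EV : kd V = kd (Theta g)).
    { destruct (typed_telescope HTg HG') as [_ (G1 & T' & _ & HV)].
      rewrite (typed_kd HV), (typed_kd HTg); destruct HG' as [-> _]; now rewrite is_kind_pis. }
    assert (Hargs' : arguments g (map tau' (dom G') ++ vs)).
    { repeat (split; auto); [|now apply tele_app].
      destruct HG' as [-> _]; rewrite ar_pis, length_app, length_map; unfold dom.
      now rewrite length_map, Ev. }
    rewrite EV; refine (IHcall _ _ _ _ eq_refl _ Hargs').
    - split; [now apply arguments_Cset|split; [now apply arguments_Cset|]].
      (* A call uses one substitution for both sides of the pair. It is [sigma'], which also covers
         the variables bound in the right-hand side and agrees with [sigma] on the left-hand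
         side. *)
      assert (Els : map (subst sigma) ls = map (subst sigma') ls).
      { apply map_ext_in; intros l Hl; apply subst_ext_free; intros x Hx; symmetry; apply Eq.
        unfold fapps; apply free_apps; right; eauto. }
      rewrite Els in Hred; destruct (Forall2_firstn_map Hred) as [L1 L2].
      exists f, ts, g, (map tau' (dom G') ++ vs), ls, (map gamma (dom G')), sigma'.
      repeat (split; auto).
      + rewrite length_app, !length_map; lia.
      + rewrite length_map, firstn_app, length_map, Nat.sub_diag, app_nil_r.
        rewrite firstn_all2; [|now rewrite length_map].
        subst tau'; clear; induction (dom G'); simpl; constructor; auto.
    (* As [geq f g], every symbol strictly below [g] is strictly below [f]. *)
    - intros h Hh; apply Hlt, (gt_geq (dep_pair_geq Hdep) Hh). }
  assert (EU : subst sigma (subst pi U) = subst tau U).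
  { rewrite subst_subst; apply subst_ext_free; intros x Hx; symmetry; apply assign_map; auto.
    destruct (typed_telescope HT HG) as [_ (G1 & T' & HG1 & HV)].
    destruct (dom_in (typed_free HV Hx)) as [A HA]; apply HG1 in HA; now apply in_dom in HA. }
  destruct Hred' as [HDU HX]; unfold type_sem in HX.
  destruct (typed_telescope HT HG) as [_ (G1 & T' & HG1 & HV)].
  (* [HX] reads the type through [subst pi U], while [U] is needed. A kind stays a kind with the
     same products. If [U] is not a kind but [subst pi U] is one, [arity_sem_true_false] weakens the
     membership. *)
  assert (HX' : arity_sem (kd U) (ar U) (subst tau U) (subst sigma r)).
  { destruct (kd U) eqn:EK.
    - assert (EK' := EK); rewrite (typed_kd HV) in EK'.
      destruct (is_kind_subst pi EK') as [EK1 EK2].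
      rewrite (is_kind_kd EK1), EK2, EU in HX; exact HX.
    - rewrite EU in *; apply arity_sem_false; auto; [apply ar_subst|].
      destruct (kd (subst pi U)) eqn:EK'.
      + rewrite <- EU in HX, HDU |- *; now apply arity_sem_true_false.
      + rewrite <- EU in HX, HDU |- *; apply arity_sem_false in HX; auto; apply ar_subst. }
  rewrite rest_app, Hrest.
  replace (kd (Theta f)) with (kd U).
  2: { rewrite (typed_kd HV), (typed_kd HT); destruct HG as [-> _]; now rewrite is_kind_pis. }
  refine (proj1 (arity_sem_apps (kd U) (subst sigma r) (ar_subst tau U)) HX' us _ _);
    [|now rewrite <- Hrest].
  destruct HG as [E _]; rewrite E, ar_pis, length_app, length_map in El.
  rewrite EG in El; exact (proj1 (Nat.add_cancel_l _ _ _) El). }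
intros f; induction (Hwf f) as [f _ IH]; apply sound_arguments; intros ts Hts.
apply Hmain with (2 := eq_refl); auto; apply no_infinite_chain_Acc, Hterm.
Qed.

(** Each declared type is in [Dcal] by adequacy in the environment of the earlier declarations, so
    its interpretation is a candidate, which contains all variables. *)
Lemma valid_Var (Gamma : env F) : (forall f, sound f) -> valid Var Gamma.
Proof.
intros Hf Hw; induction Hw as [|Gamma x A s Hw IH HA Hx]; intros y B; simpl; [tauto|].
intros [E|Hy]; [injection E as <- <-|now apply IH].
assert (HD : D (subst Var A)).
{ apply (@reducible_D Var A s).
  apply (typing_reducible (ok := fun _ => True)) with (2 := HA); auto.
  intros _; exact IH. }
apply sem_arity_sem; auto; [exact (typed_wk HA)|].
now apply cand_var, cand_type_sem.
Qed.

End Termination.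

Theorem theorem11 (S : system) (Delta : rule (fsym S) -> env (fsym S))
  (Hconfl : locally_confluent S)
  (Hpres : preserves_typing S)
  (Hws : well_structured Delta)
  (Hacc : accessible Delta)
  (Hcall : call_terminates S) :
  forall (Gamma : env (fsym S)) (t T : term (fsym S)), typed Gamma t T -> SN t.
Proof.
intros Gamma t T H.
assert (Hf := symbols_sound Hconfl Hpres Hws Hacc Hcall).
destruct (typing_reducible Hconfl Hpres (fun f _ => Hf f) H (valid_Var Hconfl Hpres Hf)) as [HD Ht].
rewrite (subst_Var t) in Ht; apply SN_sn; now apply (cand_type_sem Hconfl HD).
Qed.
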